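(* Let $p$ be a prime and let $R\to S$ be a map of Noetherian $F$-finite (ordinary, commutative) $\mathbf{F}_p$-algebras. If the cotangent complex satisfies $L_{S/R}\simeq 0$, then $S$ is relatively perfect over $R$.
   Context: An $\mathbf{F}_p$-algebra is $F$-finite if its Frobenius endomorphism $F\colon x\mapsto x^p$ is a finite ring map. For a map $R\to S$ of commutative $\mathbf{F}_p$-algebras, $F_*R$ denotes $R$ viewed as an $R$-module via $F$. $S$ is relatively perfect over $R$ if the derived relative Frobenius map $S\otimes^L_{R,F}R\to S$ is an equivalence; equivalently, the relative Frobenius $S\otimes_{R,F}R\to S$, $s\otimes r\mapsto s^pr$, is an isomorphism and $S$ and $F_*R$ are Tor-independent over $R$. $L_{S/R}$ is the (full) cotangent complex. *)

(* Defs.v *)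
From HB Require Import structures.
From mathcomp Require Import all_boot all_algebra finmap.
From mathcomp.multinomials Require Import monalg.

Set Implicit Arguments.
Unset Strict Implicit.
Unset Printing Implicit Defensive.

Import GRing.Theory.
Local Open Scope fset_scope.
Local Open Scope ring_scope.

(* Rings are [comPzRingType] throughout, so that the zero ring is allowed. *)

Definition noetherian_ring (R : comPzRingType) : Prop :=
  forall I : R -> Prop,
    I 0 -> (forall x y, I x -> I y -> I (x + y)) ->
    (forall a x, I x -> I (a * x)) ->
    exists (n : nat) (g : 'I_n -> R),
      forall x, I x <-> exists c : 'I_n -> R, x = \sum_(i < n) c i * g i.

Definition finite_ring_map (A B : comPzRingType) (f : A -> B) : Prop :=
  exists (n : nat) (g : 'I_n -> B),
    forall y, exists c : 'I_n -> A, y = \sum_(i < n) f (c i) * g i.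

Definition F_finite (p : nat) (R : comPzRingType) : Prop :=
  finite_ring_map (fun x : R => x ^+ p).

(* The polynomial ring R[X] on an arbitrary set X of variables.  The ring      *)
(* structure of [{malg R[_]}] requires R to be nonzero; the same product is    *)
(* used here without that restriction.                                        *)
Definition polyalg (R : comPzRingType) (X : choiceType) : Type :=
  {malg R[{cmonom X}]}.

HB.instance Definition _ (R : comPzRingType) (X : choiceType) :=
  GRing.Zmodule.copy (polyalg R X) {malg R[{cmonom X}]}.

Section PolyAlg.
Context (R : comPzRingType) (X : choiceType).
Local Notation P := {malg R[{cmonom X}]}.
Implicit Types (g h : P).

Definition pa_const (c : R) : polyalg R X := (<< c *g mone >> : P).

Definition pa_var (x : X) : polyalg R X := (<< (1 : R) *g ucm x >> : P).

Definition pa_mul g h : P :=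
  \sum_(k <- msupp g) \sum_(l <- msupp h) << g@_k * h@_l *g mmul k l >>.

Lemma pa_mulw (d e : {fset {cmonom X}}) g h :
  msupp g `<=` d -> msupp h `<=` e ->
  pa_mul g h = \sum_(k <- d) \sum_(l <- e) << g@_k * h@_l *g mmul k l >>.
Proof.
move=> le_d le_e; rewrite /pa_mul (big_fset_incl _ le_d) /=.
  apply/eq_bigr=> k _; apply/big_fset_incl => // l _ /mcoeff_outdom ->.
  by rewrite mulr0 monalgU0.
move=> k _ /mcoeff_outdom gk.
by rewrite big1 => // l _; rewrite gk mul0r monalgU0.
Qed.

Lemma pa_mulC : commutative pa_mul.
Proof.
move=> g h; rewrite /pa_mul exchange_big /=.
by do 2!(apply/eq_bigr => ? _); rewrite mulrC mulmC.
Qed.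

Lemma pa_mulDl : left_distributive pa_mul +%R.
Proof.
move=> g1 g2 h.
rewrite [in RHS](pa_mulw (fsubsetUl _ (msupp g2)) (fsubset_refl (msupp h))).
rewrite [in RHS](pa_mulw (fsubsetUr (msupp g1) _) (fsubset_refl (msupp h))).
rewrite (pa_mulw (msuppD_le g1 g2) (fsubset_refl (msupp h))).
rewrite -big_split /=; apply/eq_bigr=> k _.
rewrite -big_split /=; apply/eq_bigr=> l _.
by rewrite mcoeffD mulrDl monalgUD.
Qed.

Lemma pa_mul0g : left_zero 0 pa_mul.
Proof. by move=> g; rewrite /pa_mul msupp0 big_seq_fset0. Qed.

Lemma pa_mulUU c1 c2 k1 k2 :
  pa_mul << c1 *g k1 >> << c2 *g k2 >> = << c1 * c2 *g mmul k1 k2 >>.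
Proof. by rewrite (pa_mulw msuppU_le msuppU_le) !big_seq_fset1 !mcoeffUU. Qed.

Lemma pa_mulDr : right_distributive pa_mul +%R.
Proof. by move=> g h1 h2; rewrite pa_mulC pa_mulDl !(pa_mulC _ g). Qed.

Lemma pa_mulg0 : right_zero 0 pa_mul.
Proof. by move=> g; rewrite pa_mulC pa_mul0g. Qed.

Lemma pa_ind (Q : P -> Prop) :
  Q 0 -> (forall g h, Q g -> Q h -> Q (g + h)) ->
  (forall c k, Q << c *g k >>) -> forall g, Q g.
Proof.
by move=> Q0 QD QU g; rewrite (monalgE g); apply: big_ind => // k _; exact: QU.
Qed.

Lemma pa_mul1g : left_id (pa_const 1) pa_mul.
Proof.
elim/pa_ind => [|g h IHg IHh|c k]; first by rewrite pa_mulg0.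
  by rewrite pa_mulDr IHg IHh.
by rewrite pa_mulUU mul1r mul1m.
Qed.

(* Stated for an abstract product: unification of concrete monomials is slow. *)
Lemma bilinear_assoc (V : zmodType) (mul : V -> V -> V)
    (C : Type) (m : C -> C -> C) (u : C -> V) :
  left_distributive mul +%R -> right_distributive mul +%R ->
  left_zero 0 mul -> right_zero 0 mul ->
  (forall Q : V -> Prop, Q 0 -> (forall v w, Q v -> Q w -> Q (v + w)) ->
    (forall c, Q (u c)) -> forall v, Q v) ->
  (forall b c, mul (u b) (u c) = u (m b c)) -> associative m ->
  associative mul.
Proof.
move=> mulDl mulDr mul0 mulr0 ind mulU mA x y z.
elim/ind: x => [|v w IHv IHw|a]; first by rewrite !mul0.
  by rewrite !mulDl IHv IHw.
elim/ind: y => [|v w IHv IHw|b]; first by rewrite !(mul0, mulr0).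
  by rewrite !(mulDl, mulDr) IHv IHw.
elim/ind: z => [|v w IHv IHw|c]; first by rewrite !mulr0.
  by rewrite !mulDr IHv IHw.
by rewrite !mulU mA.
Qed.

Lemma pa_mulA : associative pa_mul.
Proof.
apply: (@bilinear_assoc _ pa_mul (R * {cmonom X})%type
         (fun a b => (a.1 * b.1, mmul a.2 b.2)) (fun a => << a.1 *g a.2 >>)).
- exact: pa_mulDl.
- exact: pa_mulDr.
- exact: pa_mul0g.
- exact: pa_mulg0.
- by move=> Q Q0 QD QU; apply: pa_ind => // c k; exact: (QU (c, k)).
- by move=> a b; exact: pa_mulUU.
- by move=> a b c /=; congr pair; [exact: mulrA | exact: mulmA].
Qed.

HB.instance Definition _ :=
  GRing.Zmodule_isComPzRing.Build (polyalg R X)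
    pa_mulA pa_mulC pa_mul1g pa_mulDl.

Lemma pa_const_is_additive : additive pa_const.
Proof. by move=> a b; rewrite /pa_const monalgUB. Qed.

Lemma pa_const_is_monoid_morphism : monoid_morphism pa_const.
Proof.
split=> // a b; apply: esym; rewrite /pa_const -[LHS]/(pa_mul _ _) pa_mulUU.
by rewrite mul1m.
Qed.

HB.instance Definition _ :=
  GRing.isAdditive.Build R (polyalg R X) pa_const pa_const_is_additive.
HB.instance Definition _ :=
  GRing.isMonoidMorphism.Build R (polyalg R X) pa_const
    pa_const_is_monoid_morphism.

End PolyAlg.

(* Commutative R-algebras (the library's [comAlgType R] excludes zero rings). *)
Record algOver (R : comPzRingType) := AlgOver {
  alg_sort :> comPzRingType;
  alg_in : {rmorphism R -> alg_sort}
}.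

Section StandardResolution.
Context (R : comPzRingType).

Definition polyAlg (X : choiceType) : algOver R :=
  @AlgOver R (polyalg R X) (@pa_const R X).

Definition pa_eval (X : choiceType) (B : algOver R) (h : X -> B)
    (g : polyAlg X) : B :=
  \sum_(m <- msupp g) alg_in B g@_m * \prod_(x <- finsupp m) h x ^+ m x.

Definition counit (B : algOver R) : polyAlg B -> B :=
  @pa_eval B B (fun b : B => b).

Definition polyAlg_map (X Y : choiceType) (h : X -> Y) : polyAlg X -> polyAlg Y :=
  @pa_eval X (polyAlg Y) (fun x => pa_var R (h x)).

Context (S : algOver R).

(* The standard (bar) simplicial resolution P_* -> S of the R-algebra S by     *)
(* polynomial R-algebras: P_n = [tower n.+1], i.e. P_0 = R[S] and              *)
(* P_(n+1) = R[P_n], while [tower 0 = S] is the augmentation target.           *)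
Fixpoint tower (n : nat) : algOver R :=
  if n is m.+1 then polyAlg (tower m) else S.

(* For i <= n, [face n i] is the i-th face map P_n -> P_(n-1) (P_(-1) = S),    *)
(* namely R[-]^i applied to the counit of [tower (n - i)]; values of i         *)
(* greater than n are not used.                                               *)
Fixpoint face (n i : nat) {struct i} : tower n.+1 -> tower n :=
  match i with
  | 0 => @counit (tower n)
  | j.+1 =>
      match n return tower n.+1 -> tower n with
      | 0 => @counit (tower 0)
      | m.+1 => polyAlg_map (@face m j)
      end
  end.

Arguments face : clear implicits.

Fixpoint augmentation (n : nat) : tower n -> S :=
  match n return tower n -> S with
  | 0 => fun x => x
  | m.+1 => fun x => augmentation (face m 0 x)
  end.

(* Chain complexes C_n = A^(P_n) / Rel_n given by generators and relations,    *)
(* where A is an abelian group and Rel_n is a subgroup of the finitely         *)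
(* supported functions A^(P_n) = {malg A[P_n]}; the differential is the        *)
(* alternating sum of the face maps.                                          *)

Definition push (A : zmodType) (X Y : choiceType) (h : X -> Y)
    (z : {malg A[X]}) : {malg A[Y]} :=
  \sum_(x <- msupp z) << z@_x *g h x >>.

Definition boundary (A : zmodType) (n : nat) (z : {malg A[tower n.+2]}) :
    {malg A[tower n.+1]} :=
  \sum_(i < n.+2) push (face n.+1 i) z *~ (-1) ^+ i.

Section Homology.
Context (A : zmodType) (Rel : forall n, {malg A[tower n.+1]} -> Prop).

Definition is_cycle (n : nat) : {malg A[tower n.+1]} -> Prop :=
  match n return {malg A[tower n.+1]} -> Prop with
  | 0 => fun=> True
  | m.+1 => fun z => Rel (boundary z)
  end.

Definition is_boundary (n : nat) (z : {malg A[tower n.+1]}) : Prop :=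
  exists w : {malg A[tower n.+2]}, Rel (z - boundary w).

Definition homology_vanishes (n : nat) : Prop :=
  forall z : {malg A[tower n.+1]}, is_cycle z -> is_boundary z.

End Homology.

Inductive subgroup_span (V : zmodType) (G : V -> Prop) : V -> Prop :=
| Span0 : subgroup_span G 0
| SpanG v of G v : subgroup_span G v
| SpanB v w of subgroup_span G v & subgroup_span G w :
    subgroup_span G (v - w).

(* Omega_(P_n/R) (x)_(P_n) S is the S-module generated by the symbols dx for   *)
(* x in P_n, subject to additivity, the Leibniz rule and d(R) = 0;             *)
(* << c *g x >> stands for c . dx.                                            *)
Inductive kaehler_gen (n : nat) : {malg S[tower n.+1]} -> Prop :=
| KaehlerD (c : S) x y :
    kaehler_gen (<< c *g x + y >> - << c *g x >> - << c *g y >>)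
| KaehlerM (c : S) x y :
    kaehler_gen (<< c *g x * y >> - << c * augmentation x *g y >>
                                  - << c * augmentation y *g x >>)
| KaehlerC (c : S) (a : R) :
    kaehler_gen << c *g alg_in (tower n.+1) a >>.

Definition kaehler_rel (n : nat) : {malg S[tower n.+1]} -> Prop :=
  subgroup_span (@kaehler_gen n).

(* The cotangent complex L_(S/R), in degree n Omega_(P_n/R) (x)_(P_n) S, is    *)
(* acyclic.                                                                   *)
Definition cotangent_complex_zero : Prop :=
  forall n, homology_vanishes kaehler_rel n.

Context (p : nat).

(* P_n (x)_(R,F) R is the R-module generated by the symbols x (x) 1 for x in   *)
(* P_n, subject to additivity and ax (x) c = x (x) a^p c for a in R;           *)
(* << c *g x >> stands for x (x) c.                                           *)
Inductive frobenius_gen (n : nat) : {malg R[tower n.+1]} -> Prop :=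
| FrobeniusD (c : R) x y :
    frobenius_gen (<< c *g x + y >> - << c *g x >> - << c *g y >>)
| FrobeniusZ (c a : R) x :
    frobenius_gen (<< c *g alg_in (tower n.+1) a * x >> - << a ^+ p * c *g x >>).

Definition frobenius_rel (n : nat) : {malg R[tower n.+1]} -> Prop :=
  subgroup_span (@frobenius_gen n).

(* The map P_0 (x)_(R,F) R -> S induced by the relative Frobenius,             *)
(* x (x) c |-> c x^p.                                                         *)
Definition relative_frobenius (z : {malg R[tower 1]}) : S :=
  \sum_(x <- msupp z) alg_in S z@_x * augmentation x ^+ p.

(* P_* is a flat resolution of S over R, so P_* (x)_(R,F) R represents         *)
(* S (x)^L_(R,F) R.  The derived relative Frobenius to S is an equivalence:    *)
(* the homology in positive degrees vanishes and H_0 -> S is bijective.        *)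
Definition relatively_perfect : Prop :=
  [/\ forall n, homology_vanishes frobenius_rel n.+1,
      forall s : S, exists z, relative_frobenius z = s
    & forall z, relative_frobenius z = 0 -> is_boundary frobenius_rel z].

End StandardResolution.

(* Main.v *)
From HB Require Import structures.
From Stdlib Require Import ClassicalEpsilon.
Require Import Defs.
From mathcomp Require Import all_boot all_algebra finmap ring.
From mathcomp Require Import generic_quotient ring_quotient.
From mathcomp.multinomials Require Import monalg.

(* Only H_0 and H_1 of the cotangent complex are needed: their vanishing says *)
(* that S is formally etale over R, i.e. square-zero extensions of S split    *)
(* uniquely.                                                                  *)
(*                                                                            *)
(* The relative Frobenius S (x)_(R,F) R -> S is onto because its image T      *)
(* contains all p-th powers: T -> S is finite, and it is an epimorphism since *)
(* the ideal of the diagonal of S (x)_T S is finitely generated, nil and      *)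
(* idempotent; a finite epimorphism is onto.  Its kernel K is nil, because    *)
(* the Frobenius of S (x)_(R,F) R factors through S, finitely generated,      *)
(* because S (x)_(R,F) R is a finite module over the noetherian ring S, and   *)
(* idempotent, because (S (x)_(R,F) R) / K^2 -> S splits; hence K = 0.        *)
(*                                                                            *)
(* Consequently S is flat over R.  If S / JS is flat over R / J, then so is   *)
(* S / J^[p]S over R / J^[p], since it is the base change of S / JS along the *)
(* map R / J -> R / J^[p] induced by Frobenius.  By noetherian induction on   *)
(* J: a relation with coefficients in R / J and solution s in (S / JS)^n      *)
(* defines the ideal P of those c in R for which c s is trivial.  P contains  *)
(* J and the coefficients; if P = J the relation is trivial, and otherwise    *)
(* flatness modulo all P^[q] and the Artin-Rees lemma show that s is trivial. *)
(*                                                                            *)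
(* Finally the standard resolution is exact, its terms are free and S is      *)
(* flat, so all its modules of cycles are flat and it stays exact after base  *)
(* change along Frobenius.                                                    *)

(** Vanishing of H_0 and H_1 of the cotangent complex gives uniqueness and existence of lifts along
    square-zero extensions ([formally_unramified], [formally_smooth]). Write E for S (x)_(R,F) R and
    [rho] : E -> S for the relative Frobenius. Both halves of its bijectivity rest on
    [nil_idempotent_ideal]: a finitely generated idempotent ideal of nilpotent elements is zero.
    F-finiteness of S makes S finite over the image of [rho]; killing the ideal of the diagonal then
    gives surjectivity through [finite_epimorphism_surjective]. F-finiteness of R makes E finite
    over S, so the kernel of [rho] is finitely generated and is killed as well ([rho_injective]).

    What remains is Tor-independence, which is deduced from flatness of S over R
    ([relatively_perfect_flat]). Bijectivity of the relative Frobenius carries flatness modulo J to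
    flatness modulo the Frobenius power of J ([flat_mod_frob]), and iterated Frobenius powers are
    small enough for an Artin-Rees argument ([flat_mod_step]). The standard resolution is exact
    ([alt_face_exact]) with free terms, so flatness of S makes its modules of cycles flat, and
    [ftensor_acyclic] gives vanishing in positive degrees after base change along Frobenius. In
    degree zero [ftensor_H0] reduces injectivity to that of [rho]. *)

Set Implicit Arguments.
Unset Strict Implicit.
Unset Printing Implicit Defensive.

Import GRing.Theory.
Local Open Scope fset_scope.
Local Open Scope ring_scope.

(** * Quotients *)

Lemma choice_fun (A B : Type) (Q : A -> B -> Prop) :
  (forall a, exists b, Q a b) -> exists f, forall a, Q a (f a).
Proof.
move=> AB.
exists (fun a => proj1_sig (constructive_indefinite_description _ (AB a))) => a.
by case: constructive_indefinite_description.
Qed.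

Record is_subgroup (V : zmodType) (U : V -> Prop) : Prop := IsSubgroup {
  sub0 : U 0; subB : forall x y, U x -> U y -> U (x - y) }.

Record is_ideal (Q : comPzRingType) (I : Q -> Prop) : Prop := IsIdeal {
  ideal_sub :> is_subgroup I; idealM : forall a x, I x -> I (a * x) }.

Section Quotients.
Context (V : zmodType) (U : V -> Prop) (subU : is_subgroup U).

Definition subgroup_pred : {pred V} :=
  fun x => if excluded_middle_informative (U x) then true else false.

Lemma subgroup_predP x : reflect (U x) (x \in subgroup_pred).
Proof.
rewrite /in_mem /= /subgroup_pred.
by case: excluded_middle_informative => h; constructor.
Qed.

Lemma subgroup_pred_zmod_closed : zmod_closed subgroup_pred.
Proof.
split; first by apply/subgroup_predP; exact: (sub0 subU).
move=> x y /subgroup_predP Ux /subgroup_predP Uy.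
by apply/subgroup_predP; exact: (subB subU).
Qed.

Definition subgroup_zmodClosed : zmodClosed V :=
  HB.pack subgroup_pred
    (GRing.isZmodClosed.Build V subgroup_pred subgroup_pred_zmod_closed).

Lemma zmod_quotient : exists (W : zmodType) (q : {additive V -> W}),
  (forall w, exists v, q v = w) /\ (forall v, q v = 0 <-> U v).
Proof.
pose W : zmodType := {ideal_quot subgroup_zmodClosed}.
pose q : {additive V -> W} := (\pi_W)%qT.
exists W, q; split=> [w|v].
  exists (repr (w : {ideal_quot subgroup_zmodClosed})).
  exact: (@reprK _ {ideal_quot subgroup_zmodClosed} w).
rewrite -(raddf0 q); split.
  by move/eqP; rewrite -Quotient.idealrBE subr0 => /subgroup_predP.
by move=> Uv; apply/eqP; rewrite -Quotient.idealrBE subr0; apply/subgroup_predP.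
Qed.
End Quotients.

(** The product is transported to the additive quotient through a section [r] of the projection. The
    ideal may be all of [Q]; the quotient is then the zero ring. *)
Lemma ring_quotient (Q : comPzRingType) (I : Q -> Prop) : is_ideal I ->
  exists (E : comPzRingType) (q : {rmorphism Q -> E}),
  (forall e, exists x, q x = e) /\ (forall x, q x = 0 <-> I x).
Proof.
move=> idI; have [[W cW] [q [qsurj qker]]] := zmod_quotient idI.
have [r rK] := choice_fun qsurj.
have qE x y : I (x - y) -> q x = q y.
  by move=> /qker; rewrite raddfB => /eqP; rewrite subr_eq0 => /eqP.
have rI x : I (x - r (q x)) by apply/qker; rewrite raddfB rK subrr.
pose mul (x y : W) : W := q (r x * r y).
have qM x y : mul (q x) (q y) = q (x * y).
  apply/esym/qE; have -> : x * y - r (q x) * r (q y) =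
    y * (x - r (q x)) - (- r (q x) * (y - r (q y))).
    by rewrite mulNr opprK !mulrBr addrA [y * x]mulrC [y * r _]mulrC subrK.
  by apply: (subB idI); apply: (idealM idI); exact: rI.
have mulA : associative mul.
  by move=> x y z; rewrite -(rK x) -(rK y) -(rK z) !qM mulrA.
have mulC : commutative mul by move=> x y; rewrite /mul mulrC.
have mul1 : left_id (q 1) mul by move=> x; rewrite -(rK x) qM mul1r.
have mulD : left_distributive mul (@GRing.add (GRing.Zmodule.Pack cW)).
  by move=> x y z; rewrite -(rK x) -(rK y) -(rK z) -raddfD !qM -raddfD mulrDl.
pose E : comPzRingType := HB.pack_for comPzRingType W (GRing.Zmodule.Pack cW)
   (GRing.Zmodule_isComPzRing.Build (GRing.Zmodule.Pack cW) mulA mulC mul1 mulD).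
have mq : monoid_morphism (q : Q -> E) by split=> // x y; rewrite -qM.
have aq : zmod_morphism (q : Q -> E) by move=> x y; exact: raddfB.
pose q' : {rmorphism Q -> E} := HB.pack (q : Q -> E)
  (GRing.isZmodMorphism.Build Q E q aq) (GRing.isMonoidMorphism.Build Q E q mq).
by exists E, q'.
Qed.

(** * Polynomial algebras *)

Definition mk_rmorphism (A B : comPzRingType) (h : A -> B)
    (hB : zmod_morphism h) (hM : monoid_morphism h) : {rmorphism A -> B} :=
  HB.pack h (GRing.isZmodMorphism.Build A B h hB)
    (GRing.isMonoidMorphism.Build A B h hM).

Section Lin.
Context (A V : zmodType) (X : choiceType) (phi : X -> A -> V).

(** The additive extension of << c *g x >> |-> [phi x c]; maps out of modules presented by symbols
    and relations are built from it. *)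
Definition lin (z : {malg A[X]}) : V := \sum_(x <- msupp z) phi x z@_x.

Hypothesis phiB : forall x, zmod_morphism (phi x).

Let phi0 x : phi x 0 = 0.
Proof. by rewrite -(subrr 0) phiB subrr. Qed.

Lemma linw (d : {fset X}) z :
  msupp z `<=` d -> lin z = \sum_(x <- d) phi x z@_x.
Proof.
move=> le_d; apply: big_fset_incl => // x _ /mcoeff_outdom ->.
exact: phi0.
Qed.

Lemma lin_zmod_morphism : zmod_morphism lin.
Proof.
move=> z w; rewrite (linw (msuppB_le z w)) (linw (fsubsetUl _ (msupp w))).
rewrite (linw (fsubsetUr (msupp z) _)) -sumrB; apply: eq_bigr => x _.
by rewrite mcoeffB phiB.
Qed.

Lemma linU c x : lin << c *g x >> = phi x c.
Proof. by rewrite (linw msuppU_le) big_seq_fset1 mcoeffUU. Qed.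
End Lin.

Definition lin_additive (A V : zmodType) (X : choiceType) (phi : X -> A -> V)
    (phiB : forall x, zmod_morphism (phi x)) : {additive {malg A[X]} -> V} :=
  HB.pack (lin phi) (GRing.isZmodMorphism.Build {malg A[X]} V (lin phi)
    (lin_zmod_morphism phiB)).

Lemma malg_ind (A : zmodType) (X : choiceType) (Q : {malg A[X]} -> Prop) :
  Q 0 -> (forall g h, Q g -> Q h -> Q (g + h)) ->
  (forall c k, Q << c *g k >>) -> forall g, Q g.
Proof.
by move=> Q0 QD QU g; rewrite (monalgE g); apply: big_ind => // k _; exact: QU.
Qed.

Lemma malg_ext (A V : zmodType) (X : choiceType)
    (g h : {additive {malg A[X]} -> V}) :
  (forall c x, g << c *g x >> = h << c *g x >>) -> g =1 h.
Proof.
move=> gh; elim/malg_ind => [|y z IHy IHz|//]; first by rewrite !raddf0.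
by rewrite !raddfD IHy IHz.
Qed.

Lemma pushU (A : zmodType) (X Y : choiceType) (h : X -> Y) (c : A) x :
  push h << c *g x >> = << c *g h x >>.
Proof.
apply: (@linU A {malg A[Y]} X (fun x c => << c *g h x >>)) => y a b.
exact: monalgUB.
Qed.

Lemma push_zmod_morphism (A : zmodType) (X Y : choiceType) (h : X -> Y) :
  zmod_morphism (@push A X Y h).
Proof.
apply: (@lin_zmod_morphism A _ X (fun x c => << c *g h x >>)) => x a b.
exact: monalgUB.
Qed.

HB.instance Definition _ (A : zmodType) (X Y : choiceType) (h : X -> Y) :=
  GRing.isZmodMorphism.Build {malg A[X]} {malg A[Y]} (@push A X Y h)
    (@push_zmod_morphism A X Y h).

Section MonomialEval.
Context (X : choiceType) (B : comPzRingType) (h : X -> B).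

Definition cm_eval (m : {cmonom X}) : B := \prod_(x <- finsupp m) h x ^+ m x.

Lemma cm_evalw (m : {cmonom X}) (d : {fset X}) : finsupp m `<=` d ->
  cm_eval m = \prod_(x <- d) h x ^+ m x.
Proof.
move=> le_d; apply: big_fset_incl => // x _.
by rewrite -cmE_neq0 negbK => /eqP ->; rewrite expr0.
Qed.

Lemma cm_eval1 : cm_eval mone = 1.
Proof. by rewrite /cm_eval mdom1 big_seq_fset0. Qed.

Lemma cm_evalU x : cm_eval (ucm x) = h x.
Proof. by rewrite /cm_eval mdomU big_seq_fset1 cmUU expr1. Qed.

Lemma cm_evalM m n : cm_eval (mmul m n) = cm_eval m * cm_eval n.
Proof.
rewrite [cm_eval m](cm_evalw (fsubsetUl _ (finsupp n))).
rewrite [cm_eval n](cm_evalw (fsubsetUr (finsupp m) _)) -big_split /=.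
rewrite (@cm_evalw _ (finsupp m `|` finsupp n)); last by rewrite mdomD.
by apply: eq_bigr => x _; rewrite cmM exprD.
Qed.

End MonomialEval.

Section PolyAlgTheory.
Context (R : comPzRingType).

Lemma pa_mulE (X : choiceType) (c d : R) (k l : {cmonom X}) :
  (<< c *g k >> : polyAlg R X) * (<< d *g l >> : polyAlg R X) =
  (<< c * d *g mmul k l >> : polyAlg R X).
Proof. exact: pa_mulUU. Qed.

Lemma cmonom_ind (X : choiceType) (Q : {cmonom X} -> Prop) :
  Q mone -> (forall x m, Q m -> Q (mmul (ucm x) m)) -> forall m, Q m.
Proof.
move=> Q1 QM m; have [n] := ubnP (mdeg m); elim: n m => // n IH m.
have [/eqP|m_gt0] := posnP (mdeg m); first by rewrite mdeg_eq0 => /eqP ->.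
have [x xm] : exists x, x \in finsupp m.
  have [f0|/fset0Pn //] := eqVneq (finsupp m) fset0.
  by move: m_gt0; rewrite mdegE f0 big_seq_fset0.
have mE : m = mmul (ucm x) (divcm m (ucm x)).
  apply/eqP/cmP => i; rewrite cmM cmU divcmE cmU.
  by case: eqP => [<-|_]; rewrite ?subn0 // subnKC // lt0n cmE_neq0.
move=> lt_m; rewrite mE; apply/QM/IH.
by move: lt_m; rewrite {1}mE mdegM mdegU add1n ltnS.
Qed.

Lemma polyalg_ind (X : choiceType) (Q : polyAlg R X -> Prop) :
  (forall c, Q (pa_const X c)) -> (forall x, Q (pa_var R x)) ->
  (forall g h, Q g -> Q h -> Q (g + h)) ->
  (forall g h, Q g -> Q h -> Q (g * h)) -> forall g, Q g.
Proof.
move=> QC QX QD QM; elim/malg_ind => [|g h|c m]; [|exact: QD|].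
  by rewrite -(monalgU0 mone); exact: QC.
elim/cmonom_ind: m => [|x m IH]; first exact: QC.
have -> : (<< c *g mmul (ucm x) m >> : polyAlg R X) =
    pa_var R x * (<< c *g m >> : polyAlg R X) by rewrite pa_mulE mul1r.
exact: (QM _ _ (QX x) IH).
Qed.

Section Eval.
Context (X : choiceType) (B : algOver R) (h : X -> B).

Let phiB m : zmod_morphism (fun c : R => alg_in B c * cm_eval h m).
Proof. by move=> a b; rewrite raddfB mulrBl. Qed.

Lemma pa_evalU c m : pa_eval h << c *g m >> = alg_in B c * cm_eval h m.
Proof. exact: (linU phiB). Qed.

Lemma pa_eval_zmod_morphism : zmod_morphism (@pa_eval R X B h).
Proof. exact: (lin_zmod_morphism phiB). Qed.

HB.instance Definition _ := GRing.isZmodMorphism.Build (polyAlg R X) B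
  (@pa_eval R X B h) pa_eval_zmod_morphism.

Lemma pa_eval_const c : pa_eval h (pa_const X c) = alg_in B c.
Proof. by rewrite [LHS]pa_evalU cm_eval1 mulr1. Qed.

Lemma pa_eval_var x : pa_eval h (pa_var R x) = h x.
Proof. by rewrite [LHS]pa_evalU cm_evalU rmorph1 mul1r. Qed.

Lemma pa_eval_monoid_morphism : monoid_morphism (@pa_eval R X B h).
Proof.
split; first by rewrite [LHS]pa_eval_const rmorph1.
move=> y z; elim/malg_ind: y => [|y y' IH IH'|c m].
- by rewrite mul0r raddf0 mul0r.
- by rewrite mulrDl !raddfD mulrDl; congr (_ + _).
elim/malg_ind: z => [|z z' IH IH'|d n].
- by rewrite mulr0 raddf0 mulr0.
- by rewrite mulrDr !raddfD mulrDr; congr (_ + _).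
apply: (etrans (congr1 (@pa_eval R X B h) (pa_mulE c d m n))).
apply: (etrans (pa_evalU _ _)).
rewrite cm_evalM rmorphM mulrACA.
apply: (congr2 *%R (esym (pa_evalU c m)) (esym (pa_evalU d n))).
Qed.

HB.instance Definition _ := GRing.isMonoidMorphism.Build (polyAlg R X) B
  (@pa_eval R X B h) pa_eval_monoid_morphism.
End Eval.

HB.instance Definition _ (B : algOver R) :=
  GRing.RMorphism.copy (@counit R B) (@pa_eval R B B (fun b : B => b)).
HB.instance Definition _ (X Y : choiceType) (h : X -> Y) :=
  GRing.RMorphism.copy (@polyAlg_map R X Y h)
    (@pa_eval R X (polyAlg R Y) (fun x => pa_var R (h x))).

Lemma polyalg_ext (X : choiceType) (B : comPzRingType)
    (g h : {rmorphism polyAlg R X -> B}) :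
  (forall c, g (pa_const X c) = h (pa_const X c)) ->
  (forall x, g (pa_var R x) = h (pa_var R x)) -> g =1 h.
Proof.
move=> gC gX; elim/polyalg_ind => // y z IHy IHz.
  by rewrite !rmorphD IHy IHz.
by rewrite !rmorphM IHy IHz.
Qed.

Lemma counit_const (B : algOver R) c : counit (pa_const B c) = alg_in B c.
Proof. exact: pa_eval_const. Qed.
Lemma counit_var (B : algOver R) (b : B) : counit (pa_var R b) = b.
Proof. exact: pa_eval_var. Qed.
Lemma polyAlg_map_const (X Y : choiceType) (h : X -> Y) c :
  polyAlg_map h (@pa_const R X c) = @pa_const R Y c.
Proof. exact: pa_eval_const. Qed.
Lemma polyAlg_map_var (X Y : choiceType) (h : X -> Y) x :
  polyAlg_map h (pa_var R x) = pa_var R (h x).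
Proof. exact: pa_eval_var. Qed.
End PolyAlgTheory.

(** * The standard resolution *)

Arguments face {R S} n i _.
Arguments augmentation {R S} n _.

Section FunctorLaws.
Context (R : comPzRingType).

Lemma counit_natural (B B' : algOver R) (h : {rmorphism B -> B'}) :
  (forall c, h (alg_in B c) = alg_in B' c) ->
  forall x, counit (polyAlg_map h x) = h (counit x).
Proof.
move=> hC x; apply: (@polyalg_ext R B B'
  (@counit R B' \o @polyAlg_map R B B' h) (h \o @counit R B)) => [c|b] /=.
  by rewrite polyAlg_map_const !counit_const hC.
by rewrite polyAlg_map_var !counit_var.
Qed.

Lemma polyAlg_map_comp (X Y Z : choiceType) (h : X -> Y) (g : Y -> Z) x :
  polyAlg_map g (polyAlg_map h x) = @polyAlg_map R X Z (g \o h) x.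
Proof.
apply: (@polyalg_ext R X (polyAlg R Z)
  (@polyAlg_map R Y Z g \o @polyAlg_map R X Y h)
  (@polyAlg_map R X Z (g \o h))) => [c|b] /=.
  by rewrite !polyAlg_map_const.
by rewrite !polyAlg_map_var.
Qed.

Lemma eq_polyAlg_map (X Y : choiceType) (g h : X -> Y) :
  g =1 h -> @polyAlg_map R X Y g =1 polyAlg_map h.
Proof.
move=> gh; apply: (@polyalg_ext R X (polyAlg R Y)) => [c|b] /=.
  by rewrite !polyAlg_map_const.
by rewrite !polyAlg_map_var gh.
Qed.

Lemma polyAlg_map_id (X : choiceType) (h : X -> X) :
  h =1 id -> @polyAlg_map R X X h =1 id.
Proof.
move=> hid; apply: (@polyalg_ext R X (polyAlg R X)
  (@polyAlg_map R X X h) idfun) => [c|b] /=.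
  by rewrite !polyAlg_map_const.
by rewrite !polyAlg_map_var hid.
Qed.
End FunctorLaws.

Section SimplicialStructure.
Context (R : comPzRingType) (S : algOver R).
Local Notation P n := (tower S n).
Local Notation aug := (@augmentation R S).

Lemma face_zmod_morphism n i : zmod_morphism (@face R S n i).
Proof. by case: i => [|i]; [|case: n => [|n]] => x y; exact: raddfB. Qed.

Lemma face_monoid_morphism n i : monoid_morphism (@face R S n i).
Proof.
case: i => [|i]; [|case: n => [|n]];
  by split=> [|x y]; [exact: rmorph1 | exact: rmorphM].
Qed.

HB.instance Definition _ n i := GRing.isZmodMorphism.Build (P n.+1) (P n)
  (@face R S n i) (@face_zmod_morphism n i).
HB.instance Definition _ n i := GRing.isMonoidMorphism.Build (P n.+1) (P n)
  (@face R S n i) (@face_monoid_morphism n i).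

Lemma face_const n i c : face n i (alg_in (P n.+1) c) = alg_in (P n) c.
Proof.
case: i => [|i]; first exact: counit_const.
by case: n => [|n]; [exact: counit_const | exact: polyAlg_map_const].
Qed.

Lemma aug_zmod_morphism n : zmod_morphism (@augmentation R S n).
Proof. by elim: n => [//|n IH] x y /=; rewrite raddfB IH. Qed.

Lemma aug_monoid_morphism n : monoid_morphism (@augmentation R S n).
Proof.
elim: n => [|n [IH1 IHM]]; first by split.
by split=> [|x y] /=; rewrite ?rmorph1 ?rmorphM.
Qed.

HB.instance Definition _ n := GRing.isZmodMorphism.Build (P n) S
  (@augmentation R S n) (@aug_zmod_morphism n).
HB.instance Definition _ n := GRing.isMonoidMorphism.Build (P n) S
  (@augmentation R S n) (@aug_monoid_morphism n).

Lemma aug_const n c : aug n (alg_in (P n) c) = alg_in S c.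
Proof. by elim: n => [//|n IH]; rewrite -IH -(face_const n 0). Qed.

(** For i = 0 this is naturality of the counit; for i > 0 both sides are R[-] applied to the
    identity one level down. *)
Lemma face_face n i j (x : P n.+2) : (i <= j <= n)%N ->
  face n i (face n.+1 j.+1 x) = face n j (face n.+1 i x).
Proof.
have nat0 m k (y : P m.+2) :
    counit (polyAlg_map (@face R S m k) y) = face m k (counit y).
  exact: (@counit_natural R (P m.+1) (P m) (@face R S m k) (face_const m k) y).
elim: n i j x => [|n IH] [|i] [|j] x.
- by move=> _; exact: (nat0 0 0 x).
- by move=> le_ij; exfalso; case/andP: le_ij.
- by move=> le_ij; exfalso; case/andP: le_ij.
- by move=> le_ij; exfalso; case/andP: le_ij.
- by move=> _; exact: (nat0 n.+1 0 x).
- by move=> _; exact: (nat0 n.+1 j.+1 x).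
- by move=> le_ij; exfalso; case/andP: le_ij.
move=> le_ij.
apply: (etrans (polyAlg_map_comp _ _ _)).
apply: (etrans _ (esym (polyAlg_map_comp _ _ _))).
by apply: eq_polyAlg_map => y; exact: IH.
Qed.

Definition tvar n (x : P n) : P n.+1 := pa_var R x.

Lemma face0_tvar n (x : P n) : face n 0 (tvar x) = x.
Proof. exact: counit_var. Qed.

Lemma faceS_tvar n i (x : P n.+1) : face n.+1 i.+1 (tvar x) = tvar (face n i x).
Proof. exact: (@polyAlg_map_var R (P n.+1) (P n) (@face R S n i) x). Qed.

Lemma face1_tvar (x : P 1) : face 1 1 (tvar x) = tvar (face 0 0 x).
Proof. exact: faceS_tvar. Qed.

(** Universal property of P_0 = R[S], which is [tower S 1]: maps out of it are free on [tvar s]. *)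
Lemma tower1_eval (E : comPzRingType) (iota : {rmorphism R -> E}) (h : S -> E) :
  exists phi : {rmorphism P 1 -> E},
    (forall a, phi (alg_in (P 1) a) = iota a) /\ (forall s, phi (@tvar 0 s) = h s).
Proof.
pose phi : {rmorphism polyAlg R S -> AlgOver iota} := @pa_eval R S (AlgOver iota) h.
exists phi; split=> [a|s].
  exact: (@pa_eval_const R S (AlgOver iota) h a).
exact: (@pa_eval_var R S (AlgOver iota) h s).
Qed.

Lemma tower1_ext (E : comPzRingType) (g h : {rmorphism P 1 -> E}) :
  (forall a, g (alg_in (P 1) a) = h (alg_in (P 1) a)) ->
  (forall s, g (@tvar 0 s) = h (@tvar 0 s)) -> g =1 h.
Proof. exact: polyalg_ext. Qed.
End SimplicialStructure.

(** * Formally etale algebras *)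

Section SubgroupSpan.
Context (V : zmodType).

Lemma span_subgroup (G : V -> Prop) : is_subgroup (subgroup_span G).
Proof. by split; [exact: Span0 | exact: SpanB]. Qed.

Lemma subgroupN (U : V -> Prop) : is_subgroup U -> forall x, U x -> U (- x).
Proof.
by move=> subU x Ux; rewrite -sub0r; apply: (subB subU) => //; exact: (sub0 subU).
Qed.

Lemma subgroupD (U : V -> Prop) : is_subgroup U ->
  forall x y, U x -> U y -> U (x + y).
Proof.
move=> subU x y Ux Uy; rewrite -[y]opprK; apply: (subB subU) => //.
exact: subgroupN.
Qed.

Lemma subgroup_sum (U : V -> Prop) : is_subgroup U ->
  forall (I : Type) (r : seq I) (Q : pred I) (F : I -> V),
  (forall i, Q i -> U (F i)) -> U (\sum_(i <- r | Q i) F i).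
Proof.
by move=> subU I r Q F UF; apply: big_ind => //;
  [exact: (sub0 subU) | exact: subgroupD].
Qed.

Lemma span_kill (G : V -> Prop) (W : zmodType) (g : {additive V -> W}) :
  (forall v, G v -> g v = 0) -> forall v, subgroup_span G v -> g v = 0.
Proof.
move=> gG v; elim=> [|u /gG //|u w _ IHu _ IHw]; first exact: raddf0.
by rewrite raddfB IHu IHw subrr.
Qed.

Lemma span_sub (G U : V -> Prop) : is_subgroup U ->
  (forall v, G v -> U v) -> forall v, subgroup_span G v -> U v.
Proof.
move=> subU GU v; elim=> [|u /GU //|u w _ IHu _ IHw]; first exact: (sub0 subU).
exact: (subB subU).
Qed.
End SubgroupSpan.

(** * Kaehler differentials and derivations *)

Section AbstractKaehler.
Context (R : comPzRingType) (S T : algOver R) (aug : {rmorphism T -> S}).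

(* [kaehler_rel] with [tower S n.+1] replaced by an arbitrary R-algebra:      *)
(* unification is slow in the presence of the concrete [tower].               *)
Inductive omega_gen : {malg S[T]} -> Prop :=
| OmegaD (c : S) x y : omega_gen (<< c *g x + y >> - << c *g x >> - << c *g y >>)
| OmegaM (c : S) x y :
    omega_gen (<< c *g x * y >> - << c * aug x *g y >> - << c * aug y *g x >>)
| OmegaC (c : S) (a : R) : omega_gen << c *g alg_in T a >>.

Definition omega_rel := subgroup_span omega_gen.

Section Functional.
Context (V : zmodType) (phi : T -> S -> V).
Hypothesis phiB : forall x, zmod_morphism (phi x).
Hypothesis phiD : forall c x y, phi (x + y) c = phi x c + phi y c.
Hypothesis phiM : forall c x y, phi (x * y) c =
  phi y (c * aug x) + phi x (c * aug y).
Hypothesis phiC : forall c a, phi (alg_in T a) c = 0.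

(** Such a [phi] is a derivation over R, with [phi x c] the value of c . dx, so it factors through
    Omega_(T/R) (x)_T S. *)
Lemma lin_omega z : omega_rel z -> lin phi z = 0.
Proof.
pose L := lin_additive phiB.
have LU c x : L << c *g x >> = phi x c by exact: (linU phiB).
rewrite -[lin phi z]/(L z); move: z; apply: span_kill => v.
case=> [c x y|c x y|c a]; last by rewrite LU phiC.
  by rewrite !raddfB !LU phiD addrAC addrK subrr.
by rewrite !raddfB !LU phiM addrAC addrK subrr.
Qed.
End Functional.

Definition msc (c : S) : {malg S[T]} -> {malg S[T]} :=
  lin (fun x d => << c * d *g x >>).

Lemma msc_phiB (c : S) x :
  zmod_morphism (fun d : S => << c * d *g x >> : {malg S[T]}).
Proof. by move=> a b; rewrite mulrBr monalgUB. Qed.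

HB.instance Definition _ c := GRing.isZmodMorphism.Build {malg S[T]} {malg S[T]}
  (msc c) (lin_zmod_morphism (msc_phiB c)).

Lemma mscU c d x : msc c << d *g x >> = << c * d *g x >>.
Proof. exact: (linU (msc_phiB c)). Qed.

Lemma msc_omega c z : omega_rel z -> omega_rel (msc c z).
Proof.
elim=> [|v gen_v|v w _ IHv _ IHw]; first by rewrite raddf0; exact: Span0.
  apply: SpanG; case: gen_v => [d x y|d x y|d a]; rewrite ?raddfB /= !mscU.
  - exact: OmegaD.
  - by rewrite !mulrA; exact: OmegaM.
  - exact: OmegaC.
by rewrite raddfB; exact: SpanB.
Qed.
End AbstractKaehler.

Lemma push_lin (A V : zmodType) (X Y : choiceType) (h : X -> Y)
    (phi : Y -> A -> V) (phiB : forall x, zmod_morphism (phi x)) z :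
  lin phi (push h z) = lin (fun x => phi (h x)) z.
Proof.
pose L := lin_additive phiB.
pose L' := @lin_additive A V X (fun x => phi (h x)) (fun x => phiB (h x)).
apply: (@malg_ext _ _ _ (L \o @push A X Y h) L') => c x /=.
by rewrite pushU !linU.
Qed.

(** * Lifting along square-zero extensions *)

Section AbstractEtale.
Context (R : comPzRingType) (S P1 P2 P3 : algOver R).
Context (aug1 : {rmorphism P1 -> S}) (d0 d1 : {rmorphism P2 -> P1}).
Hypothesis augC : forall a, aug1 (alg_in P1 a) = alg_in S a.
Hypothesis d0C : forall a, d0 (alg_in P2 a) = alg_in P1 a.
Hypothesis d1C : forall a, d1 (alg_in P2 a) = alg_in P1 a.
Hypothesis aug_d : forall x, aug1 (d1 x) = aug1 (d0 x).
Context (tv1 : S -> P1).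
Hypothesis aug_tv : forall s, aug1 (tv1 s) = s.
Hypothesis H0 : forall z : {malg S[P1]}, exists w : {malg S[P2]},
  omega_rel aug1 (z - (push d0 w - push d1 w)).

(** The difference g - h is an R-derivation because products of differences vanish. The functional c
    . dx |-> g(c) (g - h)(aug x) kills boundaries, since both faces have the same augmentation, so
    H_0 = 0 makes it zero. *)
Lemma etale_unramified (E : comPzRingType) (g h : {rmorphism S -> E}) :
  (forall a, g (alg_in S a) = h (alg_in S a)) ->
  (forall x y, (g x - h x) * (g y - h y) = 0) -> g =1 h.
Proof.
move=> ghR gh0; pose phi (x : P1) (c : S) := g c * (g (aug1 x) - h (aug1 x)).
have phiB x : zmod_morphism (phi x).
  by move=> c d; rewrite /phi raddfB mulrBl.
have H z : omega_rel aug1 z -> lin phi z = 0.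
  apply: lin_omega => //.
  - by move=> c x y; rewrite /phi !rmorphD opprD addrACA mulrDr.
  - move=> c x y; rewrite /phi !rmorphM; set u := aug1 x; set v := aug1 y.
    apply/eqP; rewrite -subr_eq0; set L := _ - _.
    have -> : L = - g c * ((g u - h u) * (g v - h v)) by rewrite /L; ring.
    by rewrite gh0 mulr0.
  - by move=> c a; rewrite /phi augC ghR subrr mulr0.
pose L := lin_additive phiB.
have bd w : L (push d0 w - push d1 w) = 0.
  rewrite raddfB /= !push_lin // /lin -sumrB big1 // => y _.
  by rewrite /phi aug_d subrr.
move=> s; have [w /H] := H0 << 1 *g tv1 s >>.
rewrite -[lin phi _]/(L _) raddfB bd subr0 /= linU // /phi aug_tv rmorph1 mul1r.
by move/eqP; rewrite subr_eq0 => /eqP.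
Qed.

Context (tv2 : P1 -> P2) (tv1D : forall x, d1 (tv2 x) = tv1 (aug1 x)).
Hypothesis d0_tv : forall x, d0 (tv2 x) = x.
Hypothesis P1_eval : forall (E : comPzRingType) (iota : {rmorphism R -> E})
  (h : S -> E), exists phi : {rmorphism P1 -> E},
    (forall a, phi (alg_in P1 a) = iota a) /\ (forall s, phi (tv1 s) = h s).
Hypothesis P1_ext : forall (E : comPzRingType) (g h : {rmorphism P1 -> E}),
  (forall a, g (alg_in P1 a) = h (alg_in P1 a)) ->
  (forall s, g (tv1 s) = h (tv1 s)) -> g =1 h.
Context (aug2 : {rmorphism P2 -> S}) (aug2E : forall x, aug2 x = aug1 (d0 x)).
Context (e0 e1 e2 : P3 -> P2).
Hypothesis d0e1 : forall x, d0 (e1 x) = d0 (e0 x).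
Hypothesis d0e2 : forall x, d0 (e2 x) = d1 (e0 x).
Hypothesis d1e2 : forall x, d1 (e2 x) = d1 (e1 x).
Hypothesis H1 : forall w : {malg S[P2]},
  omega_rel aug1 (push d0 w - push d1 w) ->
  exists u : {malg S[P3]},
    omega_rel aug2 (w - (push e0 u - push e1 u + push e2 u)).

(** Lift the augmentation to a ring map [phi] from the polynomial ring P1 to E. The failure of [phi]
    to equalise the faces is a derivation [D] into the kernel of [pi], whose functional [L] is a
    1-cocycle. As H_1 = 0 and H_0 = 0, [L] is the coboundary of a derivation [delta] on P1. Then
    [phi - delta] is a ring map equalising the faces, and it descends to the section [sigma]. *)
Lemma etale_smooth (E : comPzRingType) (pi : {rmorphism E -> S})
    (iota : {rmorphism R -> E}) :
  (forall a, pi (iota a) = alg_in S a) -> (forall s, exists e, pi e = s) ->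
  (forall x y, pi x = 0 -> pi y = 0 -> x * y = 0) ->
  exists sigma : {rmorphism S -> E}, (forall s, pi (sigma s) = s) /\
    (forall a, sigma (alg_in S a) = iota a).
Proof.
move=> piC pi_surj sq0.
have [s0 s0K] := choice_fun pi_surj.
have [phi [phiC phi_tv]] := P1_eval iota s0.
have pi_phi : pi \o phi =1 aug1.
  by apply: P1_ext => [a|s] /=; rewrite ?phiC ?phi_tv ?piC ?augC ?s0K ?aug_tv.
pose D (y : P2) := phi (d0 y) - phi (d1 y).
have piD y : pi (D y) = 0.
  by rewrite rmorphB -!/((pi \o phi) _) !pi_phi aug_d subrr.
(* The kernel of pi is an S-module because it squares to zero. *)
have act e e' k : pi e = pi e' -> pi k = 0 -> e * k = e' * k.
  move=> ee' k0; apply/eqP; rewrite -subr_eq0 -mulrBl sq0 //.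
  by rewrite rmorphB ee' subrr.
pose PHI (y : P2) (c : S) := s0 c * D y.
have PHIB y : zmod_morphism (PHI y).
  move=> c d; rewrite /PHI -mulrBl; apply: act => //.
  by rewrite rmorphB !s0K.
pose L := lin_additive PHIB.
have LU c y : L << c *g y >> = s0 c * D y by exact: (linU PHIB).
have piL w : pi (L w) = 0.
  rewrite /L /= /lin rmorph_sum big1 // => y _.
  by rewrite /PHI rmorphM piD mulr0.
have Lrel w : omega_rel aug2 w -> L w = 0.
  apply: lin_omega => //.
  - by move=> c x y; rewrite /PHI /D !rmorphD opprD addrACA mulrDr.
  (* D(xy) = phi(d0 x) D(y) + phi(d1 y) D(x), and these two coefficients lift [aug2 x] and
     [aug2 y]. *)
  - move=> c x y; have -> : PHI y (c * aug2 x) = s0 c * phi (d0 x) * D y.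
      apply: act => //; rewrite rmorphM !s0K aug2E.
      by rewrite -[pi (phi _)]/((pi \o phi) _) pi_phi.
    have -> : PHI x (c * aug2 y) = s0 c * phi (d1 y) * D x.
      apply: act => //; rewrite rmorphM !s0K aug2E -aug_d.
      by rewrite -[pi (phi _)]/((pi \o phi) _) pi_phi.
    by rewrite /PHI /D !rmorphM; ring.
  - by move=> c a; rewrite /PHI /D d0C d1C subrr mulr0.
have Lcocycle u : L (push e0 u - push e1 u + push e2 u) = 0.
  rewrite raddfD raddfB /= !push_lin // /lin -sumrB -big_split big1 //= => y _.
  by rewrite /PHI -mulrBr -mulrDr /D d0e1 d0e2 d1e2; ring.
have Lker w : omega_rel aug1 (push d0 w - push d1 w) -> L w = 0.
  move=> /H1 [u /Lrel]; rewrite raddfB Lcocycle subr0; exact.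
have [bd bdE] : exists bd : {additive {malg S[P2]} -> {malg S[P1]}},
    forall w, bd w = push d0 w - push d1 w.
  by exists (@push S P2 P1 d0 \- @push S P2 P1 d1).
have bdU c y : bd << c *g y >> = << c *g d0 y >> - << c *g d1 y >>.
  by rewrite bdE !pushU.
have bd_msc c w : bd (@msc R S P2 c w) = @msc R S P1 c (bd w).
  rewrite !bdE raddfB /=; congr (_ - _).
    apply: (@malg_ext _ _ _ (@push _ _ _ d0 \o @msc R S P2 c)
                            (@msc R S P1 c \o @push _ _ _ d0)).
    by move=> e y /=; rewrite mscU !pushU mscU.
  apply: (@malg_ext _ _ _ (@push _ _ _ d1 \o @msc R S P2 c)
                          (@msc R S P1 c \o @push _ _ _ d1)).
  by move=> e y /=; rewrite mscU !pushU mscU.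
have L_msc c w : L (@msc R S P2 c w) = s0 c * L w.
  apply: (@malg_ext _ _ _ (L \o @msc R S P2 c)
    (GRing.mull_fun (s0 c) L)) => e y.
  change (L (@msc R S P2 c << e *g y >>) = s0 c * L << e *g y >>).
  rewrite mscU (LU (c * e)) (LU e) mulrA.
  by apply: act => //; rewrite rmorphM !s0K.
have [W [q [_ qP]]] := zmod_quotient (span_subgroup (omega_gen aug1)).
have qE x y : omega_rel aug1 (x - y) -> q x = q y.
  by move=> /qP; rewrite raddfB => /eqP; rewrite subr_eq0 => /eqP.
(* H_0 = 0 makes each symbol dx a boundary modulo relations; [delta x] is the value of [L] on a
   chosen preimage. *)
have [w wP] : exists w : P1 -> {malg S[P2]},
    forall x, omega_rel aug1 (<< 1 *g x >> - bd (w x)).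
  apply: (choice_fun (Q := fun x w => omega_rel aug1 (<< 1 *g x >> - bd w))) => x.
  by have [w wP] := H0 << 1 *g x >>; exists w; rewrite bdE.
have qw c x : q (bd (@msc R S P2 c (w x))) = q << c *g x >>.
  symmetry; apply: qE; rewrite bd_msc -{1}[c]mulr1 -mscU -raddfB.
  exact: msc_omega.
pose delta x := L (w x).
(* [L] vanishes on 1-cycles, so it depends only on the class of the boundary; this makes [delta]
   independent of choices. *)
have Lq v v' : q (bd v) = q (bd v') -> L v = L v'.
  move=> qv; have : L (v - v') = 0; last first.
    by rewrite raddfB => /eqP; rewrite subr_eq0 => /eqP.
  apply: Lker; rewrite -bdE; apply/qP.
  by rewrite !raddfB qv subrr.
have Ldelta v x : q (bd v) = q << 1 *g x >> -> L v = delta x.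
  by move=> qv; apply: Lq; rewrite qv; apply: qE.
have qD c x y : q << c *g x + y >> = q << c *g x >> + q << c *g y >>.
  rewrite -raddfD; apply: qE; rewrite opprD addrA; apply: SpanG; exact: OmegaD.
have qM x y : q << 1 *g x * y >> = q << aug1 x *g y >> + q << aug1 y *g x >>.
  rewrite -raddfD; apply: qE; rewrite opprD addrA; apply: SpanG.
  by have := OmegaM aug1 1 x y; rewrite !mul1r.
have qC a : q << 1 *g alg_in P1 a >> = 0.
  by apply/qP/SpanG; exact: OmegaC.
have deltaD x y : delta (x + y) = delta x + delta y.
  rewrite -[RHS]raddfD; symmetry; apply: Ldelta.
  by rewrite !raddfD qD; congr (_ + _); symmetry; apply: qE.
have pidelta x : pi (delta x) = 0 by exact: piL.
have pi_s0_aug x : pi (s0 (aug1 x)) = pi (phi x).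
  by rewrite s0K -pi_phi.
have deltaM x y : delta (x * y) = phi x * delta y + phi y * delta x.
  rewrite -(act _ _ _ (pi_s0_aug x) (pidelta y)).
  rewrite -(act _ _ _ (pi_s0_aug y) (pidelta x)).
  rewrite -!L_msc -raddfD; symmetry; apply: Ldelta.
  by rewrite raddfD raddfD 2!qw qM.
have deltaC a : delta (alg_in P1 a) = 0.
  rewrite -(raddf0 L); symmetry; apply: Ldelta.
  by rewrite qC !raddf0.
have deltad y : delta (d0 y) - delta (d1 y) = D y.
  have <- : L << 1 *g y >> = D y.
    by rewrite LU -[RHS]mul1r; apply: act => //; rewrite s0K rmorph1.
  rewrite -raddfB; apply: Lq; rewrite raddfB bdU !raddfB.
  by congr (_ - _); symmetry; apply: qE.
pose psi x := phi x - delta x.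
have deltaB x y : delta (x - y) = delta x - delta y.
  by apply/eqP; rewrite eq_sym subr_eq -deltaD subrK.
have psiB x y : psi (x - y) = psi x - psi y.
  by rewrite /psi deltaB rmorphB !opprD !opprK addrACA.
have psiM x y : psi (x * y) = psi x * psi y.
  have dd : delta x * delta y = 0 by apply: sq0.
  have -> : psi x * psi y = phi x * phi y -
     (phi x * delta y + phi y * delta x) + delta x * delta y by rewrite /psi; ring.
  by rewrite dd addr0 /psi rmorphM deltaM.
have psiC a : psi (alg_in P1 a) = iota a by rewrite /psi deltaC subr0 phiC.
have psid y : psi (d0 y) = psi (d1 y).
  apply/eqP; rewrite -subr_eq0 /psi opprD opprK addrACA -/(D y) -deltad.
  by rewrite addrACA subrr add0r addNr.
(* [psi] equalises the faces, and [tv2 x] has faces [x] and [tv1 (aug1 x)], so [psi] is constant on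
   the fibres of [aug1]. *)
pose sigma s := psi (tv1 s).
have sigma_aug x : sigma (aug1 x) = psi x.
  by rewrite /sigma -tv1D -psid d0_tv.
have sigmaC a : sigma (alg_in S a) = iota a.
  by rewrite -augC sigma_aug psiC.
have sigmaB : zmod_morphism sigma.
  move=> s t; rewrite -{1}(aug_tv s) -{1}(aug_tv t) -rmorphB sigma_aug.
  exact: psiB.
have sigmaM : monoid_morphism sigma.
  split=> [|s t]; first by rewrite -(rmorph1 (alg_in S)) sigmaC rmorph1.
  rewrite -{1}(aug_tv s) -{1}(aug_tv t) -rmorphM sigma_aug; exact: psiM.
exists (mk_rmorphism sigmaB sigmaM); split=> //= s.
by rewrite /sigma /psi rmorphB pidelta subr0 phi_tv s0K.
Qed.
End AbstractEtale.

Lemma alternating_sum2 (V : zmodType) (F : nat -> V) :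
  \sum_(i < 2) F i *~ (-1) ^+ i = F 0 - F 1.
Proof. by rewrite !big_ord_recl big_ord0 addr0 expr0 mulr1z expr1 mulrNz mulr1z. Qed.

Lemma alternating_sum3 (V : zmodType) (F : nat -> V) :
  \sum_(i < 3) F i *~ (-1) ^+ i = F 0 - F 1 + F 2.
Proof.
by rewrite !big_ord_recl big_ord0 addr0 expr0 mulr1z expr1 mulrNz mulr1z addrA.
Qed.

Section FormallyEtale.
Context (R : comPzRingType) (S : algOver R).
Local Notation P n := (tower S n).

Lemma kaehler_omega n (z : {malg S[P n.+1]}) :
  kaehler_rel z <-> omega_rel (@augmentation R S n.+1) z.
Proof.
split; apply: span_sub => [|v]; first exact: span_subgroup.
- by case=> [c x y|c x y|c a]; apply: SpanG;
    [exact: OmegaD|exact: OmegaM|exact: OmegaC].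
- exact: span_subgroup.
by case=> [c x y|c x y|c a]; apply: SpanG;
  [exact: KaehlerD|exact: KaehlerM|exact: KaehlerC].
Qed.

Lemma boundary0E (A : zmodType) (w : {malg A[P 2]}) :
  boundary w = push (@face R S 1 0) w - push (@face R S 1 1) w.
Proof. exact: (alternating_sum2 (fun i => push (@face R S 1 i) w)). Qed.

Lemma boundary1E (A : zmodType) (w : {malg A[P 3]}) :
  boundary w = push (@face R S 2 0) w - push (@face R S 2 1) w
    + push (@face R S 2 2) w.
Proof. exact: (alternating_sum3 (fun i => push (@face R S 2 i) w)). Qed.

Lemma aug_face1 (y : P 2) :
  @augmentation R S 1 (face 1 1 y) = @augmentation R S 1 (face 1 0 y).
Proof. exact: (@face_face R S 0 0 0 y isT). Qed.

Lemma aug_tvar0 (s : S) : augmentation 1 (@tvar R S 0 s) = s.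
Proof. exact: (@face0_tvar R S 0 s). Qed.

Hypothesis H0 : homology_vanishes (@kaehler_rel R S) 0.

Let H0' (z : {malg S[P 1]}) : exists w : {malg S[P 2]},
  omega_rel (@augmentation R S 1)
    (z - (push (@face R S 1 0) w - push (@face R S 1 1) w)).
Proof.
have [w /kaehler_omega] := H0 (z := z) I; rewrite boundary0E => Hw.
by exists w.
Qed.

Lemma formally_unramified (E : comPzRingType) (g h : {rmorphism S -> E}) :
  (forall a, g (alg_in S a) = h (alg_in S a)) ->
  (forall x y, (g x - h x) * (g y - h y) = 0) -> g =1 h.
Proof.
exact: (@etale_unramified R S (P 1) (P 2) (@augmentation R S 1)
  (@face R S 1 0) (@face R S 1 1) (@aug_const R S 1) aug_face1 (@tvar R S 0)
  aug_tvar0 H0').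
Qed.

Hypothesis H1 : homology_vanishes (@kaehler_rel R S) 1.

Let H1' (w : {malg S[P 2]}) :
  omega_rel (@augmentation R S 1) (push (@face R S 1 0) w - push (@face R S 1 1) w) ->
  exists u : {malg S[P 3]}, omega_rel (@augmentation R S 2)
    (w - (push (@face R S 2 0) u - push (@face R S 2 1) u + push (@face R S 2 2) u)).
Proof.
rewrite -boundary0E => /kaehler_omega Hw.
have [u /kaehler_omega] := H1 (z := w) Hw; rewrite boundary1E => Hu.
by exists u.
Qed.

Lemma formally_smooth (E : comPzRingType) (pi : {rmorphism E -> S})
    (iota : {rmorphism R -> E}) :
  (forall a, pi (iota a) = alg_in S a) -> (forall s, exists e, pi e = s) ->
  (forall x y, pi x = 0 -> pi y = 0 -> x * y = 0) ->
  exists sigma : {rmorphism S -> E}, (forall s, pi (sigma s) = s) /\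
    (forall a, sigma (alg_in S a) = iota a).
Proof.
exact: (@etale_smooth R S (P 1) (P 2) (P 3) (@augmentation R S 1)
  (@face R S 1 0) (@face R S 1 1) (@aug_const R S 1) (@face_const R S 1 0)
  (@face_const R S 1 1) aug_face1 (@tvar R S 0) aug_tvar0 H0'
  (@tvar R S 1) (@face1_tvar R S) (@face0_tvar R S 1) (@tower1_eval R S)
  (@tower1_ext R S) (@augmentation R S 2) (fun x => erefl)
  (@face R S 2 0) (@face R S 2 1) (@face R S 2 2)
  (fun x => @face_face R S 1 0 0 x isT) (fun x => @face_face R S 1 0 1 x isT)
  (fun x => @face_face R S 1 1 1 x isT) H1' E pi iota).
Qed.
End FormallyEtale.

(** * Tensor products *)

(* Keeps the concrete [polyalg], on which unification is slow, out of sight. *)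
Lemma polyalg_free (A : comPzRingType) (X : choiceType) :
  exists (Q : comPzRingType) (mon : A -> {cmonom X} -> Q),
  [/\ mon 1 mone = 1,
      forall a b m n, mon a m * mon b n = mon (a * b) (mmul m n),
      forall U : Q -> Prop, U 0 -> (forall g h, U g -> U h -> U (g + h)) ->
        (forall a m, U (mon a m)) -> forall g, U g
    & forall (V : zmodType) (phi : {cmonom X} -> A -> V),
        (forall m, zmod_morphism (phi m)) ->
        exists L : {additive Q -> V}, forall a m, L (mon a m) = phi m a].
Proof.
exists (polyAlg A X), (fun a m => << a *g m >> : polyAlg A X); split.
- by [].
- exact: pa_mulE.
- exact: malg_ind.
move=> V phi phiB.
exists (lin_additive phiB : {additive polyAlg A X -> V}) => a m.
exact: (linU phiB).
Qed.

(** [C a b] says that a and b are images of the same scalar. A relation covers both the tensor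
    product over a subring and base change along Frobenius. *)
Record balanced (A B : comPzRingType) (C : A -> B -> Prop) (V : zmodType)
    (beta : A -> B -> V) : Prop := Balanced {
  balancedBl : forall a a' b, beta (a - a') b = beta a b - beta a' b;
  balancedBr : forall a b b', beta a (b - b') = beta a b - beta a b';
  balancedC : forall a b, C a b -> forall x y, beta (a * x) y = beta x (b * y) }.

Section TensorProduct.
Context (A B Q : comPzRingType) (C : A -> B -> Prop) (mon : A -> {cmonom B} -> Q).
Hypothesis mon1 : mon 1 mone = 1.
Hypothesis monM : forall a b m n, mon a m * mon b n = mon (a * b) (mmul m n).
Hypothesis mon_ind : forall U : Q -> Prop,
  U 0 -> (forall g h, U g -> U h -> U (g + h)) ->
  (forall a m, U (mon a m)) -> forall g, U g.
Hypothesis mon_lin : forall (V : zmodType) (phi : {cmonom B} -> A -> V),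
  (forall m, zmod_morphism (phi m)) ->
  exists L : {additive Q -> V}, forall a m, L (mon a m) = phi m a.
Local Notation ev m := (cm_eval (fun b : B => b) m).

(* The relations of the tensor product are those which hold in the target of  *)
(* every balanced map.                                                        *)
Definition tensor_ideal (g : Q) : Prop :=
  forall (V : zmodType) (beta : A -> B -> V) (L : {additive Q -> V}),
  balanced C beta -> (forall a m, L (mon a m) = beta a (ev m)) -> L g = 0.

(** Multiplication by the monomial [mon a m] turns [beta] into (b, y) |-> beta(a b, ev(m) y), which
    is again balanced. *)
Lemma tensor_ideal_ideal : is_ideal tensor_ideal.
Proof.
have subI : is_subgroup tensor_ideal.
  split=> [V beta L _ _|x y Ix Iy V beta L bal LE]; first exact: raddf0.
  by rewrite raddfB (Ix V beta) // (Iy V beta) // subrr.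
split=> // u x Ix; elim/mon_ind: u => [|u v IHu IHv|a m].
- by rewrite mul0r; exact: (sub0 subI).
- by rewrite mulrDl; exact: (subgroupD subI).
move=> V beta L bal LE.
have bal' : balanced C (fun b y => beta (a * b) (ev m * y)).
  split=> [b b' y|y b b'|b c Cbc z y] /=.
  - by rewrite mulrBr (balancedBl bal).
  - by rewrite mulrBr (balancedBr bal).
  - by rewrite mulrCA (balancedC bal Cbc) mulrCA.
have [L' L'E] := mon_lin (fun m b b' => balancedBl bal' b b' (ev m)).
rewrite -(Ix V _ L' bal' L'E) /=.
elim/mon_ind: (x) => [|u v IHu IHv|b n].
- by rewrite mulr0 !raddf0.
- by rewrite mulrDr !raddfD IHu IHv.
by rewrite monM LE L'E cm_evalM.
Qed.

(** The tensor product is a quotient of the polynomial ring A[B], in which [mon a m] stands for a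
    (x) ev(m). The universal property is kept for additive maps, because later balanced maps need
    not be multiplicative. *)
Lemma abstract_tensor_exists : exists (E : comPzRingType)
    (i : {rmorphism A -> E}) (j : {rmorphism B -> E}),
  [/\ forall a b, C a b -> i a = j b,
      forall e, exists s : seq (A * B), e = \sum_(u <- s) i u.1 * j u.2
    & forall (V : zmodType) (beta : A -> B -> V), balanced C beta ->
      forall s : seq (A * B), \sum_(u <- s) i u.1 * j u.2 = 0 ->
      \sum_(u <- s) beta u.1 u.2 = 0].
Proof.
have [E [q [q_surj qP]]] := ring_quotient tensor_ideal_ideal.
have qE x y : (forall (V : zmodType) beta (L : {additive Q -> V}), balanced C beta ->
    (forall a m, L (mon a m) = beta a (ev m)) -> L x = L y) -> q x = q y.
  move=> xy; apply/eqP; rewrite -subr_eq0 -rmorphB; apply/eqP/qP.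
  by move=> V beta L bal LE; rewrite raddfB (xy V beta) // subrr.
pose i a := q (mon a mone); pose j b := q (mon 1 (ucm b)).
have iB : zmod_morphism i.
  move=> x y; rewrite -rmorphB; apply: qE => V beta L bal LE.
  by rewrite raddfB !LE (balancedBl bal).
have iM : monoid_morphism i.
  split=> [|x y]; first by rewrite /i mon1 rmorph1.
  rewrite /i -rmorphM; apply: qE => V beta L bal LE.
  by rewrite monM !LE cm_evalM cm_eval1 mulr1.
have jB : zmod_morphism j.
  move=> x y; rewrite -rmorphB; apply: qE => V beta L bal LE.
  by rewrite raddfB !LE !cm_evalU (balancedBr bal).
have jM : monoid_morphism j.
  split=> [|x y].
    rewrite /j -(rmorph1 q) -mon1; apply: qE => V beta L bal LE.
    by rewrite !LE cm_evalU cm_eval1.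
  rewrite /j -rmorphM; apply: qE => V beta L bal LE.
  by rewrite monM !LE cm_evalM !cm_evalU mulr1.
have ij a b : i a * j b = q (mon a (ucm b)).
  rewrite -rmorphM; apply: qE => V beta L bal LE.
  by rewrite monM !LE cm_evalM cm_eval1 mul1r mulr1.
exists E, (mk_rmorphism iB iM), (mk_rmorphism jB jM); split=> /=.
- move=> a b Cab; apply: qE => V beta L bal LE.
  by rewrite !LE cm_eval1 cm_evalU -{1}[a]mulr1 (balancedC bal Cab) mulr1.
- move=> e; have [x <-] := q_surj e; elim/mon_ind: x => [|u v [s us] [t vt]|a m].
  + by exists [::]; rewrite big_nil rmorph0.
  + by exists (s ++ t); rewrite big_cat rmorphD us vt.
  + exists [:: (a, ev m)]; rewrite big_seq1 ij; apply: qE => V beta L bal LE.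
    by rewrite !LE cm_evalU.
move=> V beta bal s; pose x := \sum_(u <- s) mon u.1 (ucm u.2).
have -> : \sum_(u <- s) i u.1 * j u.2 = q x.
  by rewrite rmorph_sum; apply: eq_bigr => u _; exact: ij.
have [L LE] := mon_lin (fun m b b' => balancedBl bal b b' (ev m)).
move=> /qP /(_ V beta L bal LE) Lx0.
transitivity (L x); last by [].
rewrite raddf_sum; apply: eq_bigr => u _.
by rewrite LE cm_evalU.
Qed.
End TensorProduct.

Lemma tensor_exists (A B : comPzRingType) (C : A -> B -> Prop) :
  exists (E : comPzRingType) (i : {rmorphism A -> E}) (j : {rmorphism B -> E}),
  [/\ forall a b, C a b -> i a = j b,
      forall e, exists s : seq (A * B), e = \sum_(u <- s) i u.1 * j u.2
    & forall (V : zmodType) (beta : A -> B -> V), balanced C beta ->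
      forall s : seq (A * B), \sum_(u <- s) i u.1 * j u.2 = 0 ->
      \sum_(u <- s) beta u.1 u.2 = 0].
Proof.
by have [Q [mon [mon1 monM mon_ind mon_lin]]] := polyalg_free A B;
  exact: (abstract_tensor_exists C mon1 monM mon_ind mon_lin).
Qed.

(** * Ideals and finite epimorphisms in characteristic p *)

Section CharP.
Context (p : nat) (A : comPzRingType) (p_prime : prime p).
Hypothesis charA : (p%:R : A) = 0.

Lemma frobenius_add (x y : A) : (x + y) ^+ p = x ^+ p + y ^+ p.
Proof.
case: p p_prime charA => // n n_prime char0.
rewrite exprDn big_ord_recl big_ord_recr /= bin0 binn !mulr1n subn0 subnn.
rewrite !expr0 mulr1 mul1r big1 ?add0r // => i _.
have [|k ->] := dvdnP (@prime_dvd_bin (bump 0 i) n.+1 n_prime _).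
  by rewrite /bump /= add1n ltnS ltn_ord.
by rewrite mulrnA -mulr_natl char0 mul0r.
Qed.

Lemma frobenius0 : (0 : A) ^+ p = 0.
Proof. by rewrite expr0n; case: p p_prime. Qed.

Lemma frobenius_opp (x : A) : (- x) ^+ p = - x ^+ p.
Proof.
by apply/eqP; rewrite -addr_eq0 -frobenius_add addNr frobenius0.
Qed.

Lemma frobenius_sub : zmod_morphism (fun x : A => x ^+ p).
Proof. by move=> x y; rewrite frobenius_add frobenius_opp. Qed.

Lemma frobenius_monoid : monoid_morphism (fun x : A => x ^+ p).
Proof. by split=> [|x y]; rewrite ?expr1n ?exprMn. Qed.

Definition frobenius : {rmorphism A -> A} :=
  mk_rmorphism frobenius_sub frobenius_monoid.

Lemma frobenius_sum (I : Type) (r : seq I) (P : pred I) (F : I -> A) :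
  (\sum_(i <- r | P i) F i) ^+ p = \sum_(i <- r | P i) F i ^+ p.
Proof. exact: (rmorph_sum frobenius). Qed.
End CharP.

Section IdealSpan.
Context (A : comPzRingType).

Inductive ideal_span (G : A -> Prop) : A -> Prop :=
| IdealSpan0 : ideal_span G 0
| IdealSpanD a g x of G g & ideal_span G x : ideal_span G (x + a * g).

Lemma ideal_span_add G x y :
  ideal_span G x -> ideal_span G y -> ideal_span G (x + y).
Proof.
move=> Gx; elim=> [|a g z Gg _ IH]; first by rewrite addr0.
by rewrite addrA; apply: IdealSpanD.
Qed.

Lemma ideal_span_mul G a x : ideal_span G x -> ideal_span G (a * x).
Proof.
elim=> [|b g z Gg _ IH]; first by rewrite mulr0; exact: IdealSpan0.
by rewrite mulrDr mulrA; apply: IdealSpanD.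
Qed.

Lemma ideal_span_ideal G : is_ideal (ideal_span G).
Proof.
split=> [|a x]; last exact: ideal_span_mul.
split=> [|x y Gx Gy]; first exact: IdealSpan0.
by rewrite -mulN1r; apply: ideal_span_add => //; exact: ideal_span_mul.
Qed.

Lemma ideal_span_gen (G : A -> Prop) g : G g -> ideal_span G g.
Proof.
by move=> Gg; rewrite -[g]mul1r -[_ * _]add0r; apply: IdealSpanD => //;
  exact: IdealSpan0.
Qed.

Lemma ideal_span_min (G I : A -> Prop) : is_ideal I ->
  (forall g, G g -> I g) -> forall x, ideal_span G x -> I x.
Proof.
move=> idI GI x; elim=> [|a g z Gg _ IH]; first exact: (sub0 idI).
by apply: (subgroupD idI) => //; apply: (idealM idI); exact: GI.
Qed.

(** Nakayama by elimination of generators. Idempotence, expressed as: every ideal containing the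
    products contains K, writes the last generator as a combination of all generators with
    coefficients in K. *)
Lemma nil_idempotent_ideal (K : A -> Prop) (n : nat) (x : nat -> A) :
  (forall k, K k -> exists m, k ^+ m = 0) ->
  (forall I, is_ideal I -> (forall a b, K a -> K b -> I (a * b)) ->
    forall k, K k -> I k) ->
  is_ideal K -> (forall i, K (x i)) ->
  (forall k, K k -> exists c : nat -> A, k = \sum_(i < n) c i * x i) ->
  forall k, K k -> k = 0.
Proof.
move=> Knil Kidem idK Kx; elim: n => [|n IH] gen.
  by move=> k /gen [c]; rewrite big_ord0.
apply: IH => k /gen [c ->]; rewrite big_ord_recr /=.
have [d [Kd xE]] : exists d : nat -> A, (forall i, K (d i)) /\
    x n = \sum_(i < n.+1) d i * x i.
  apply: (Kidem (fun y => exists d : nat -> A, (forall i, K (d i)) /\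
    y = \sum_(i < n.+1) d i * x i)) => //.
    split=> [|a y [d [Kd ->]]]; last first.
      exists (fun i => a * d i); split=> [i|]; first exact: (idealM idK).
      by rewrite mulr_sumr; apply: eq_bigr => i _; rewrite mulrA.
    split=> [|y z [d [Kd ->]] [e [Ke ->]]].
      exists (fun=> 0); split=> [_|]; first exact: (sub0 idK).
      by rewrite big1 // => i _; rewrite mul0r.
    exists (fun i => d i - e i); split=> [i|]; first exact: (subB idK).
    by rewrite -sumrB; apply: eq_bigr => i _; rewrite mulrBl.
  move=> a b Ka /gen [e ->]; exists (fun i => a * e i); split.
    by move=> i; rewrite mulrC; exact: (idealM idK).
  by rewrite mulr_sumr; apply: eq_bigr => i _; rewrite mulrA.
have [m dm0] := Knil _ (Kd n).
(* As [d n] is nilpotent, a finite geometric series inverts 1 - [d n], and the last generator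
   becomes redundant. *)
have xnE : x n = (\sum_(i < m) d n ^+ i) * \sum_(i < n) d i * x i.
  have -> : \sum_(i < n) d i * x i = (1 - d n) * x n.
    by rewrite mulrBl mul1r {1}xE big_ord_recr /= addrK.
  rewrite mulrA [_ * (1 - _)]mulrC -opprB mulNr -subrX1 dm0 sub0r opprK.
  by rewrite mul1r.
move: (\sum_(j < m) d n ^+ j) xnE => u xnE.
exists (fun i => c i + c n * u * d i).
rewrite xnE !mulr_sumr -big_split; apply: eq_bigr => i _ /=.
by rewrite mulrDl !mulrA.
Qed.
End IdealSpan.

Section FiniteEpimorphism.
Context (p : nat) (S : comPzRingType) (p_prime : prime p).
Hypothesis charS : (p%:R : S) = 0.
Context (T : S -> Prop).
Hypothesis T1 : T 1.
Hypothesis TB : forall x y, T x -> T y -> T (x - y).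
Hypothesis TM : forall x y, T x -> T y -> T (x * y).
Hypothesis Tp : forall x, T (x ^+ p).
Hypothesis unram : forall (E : comPzRingType) (g h : {rmorphism S -> E}),
  (forall t, T t -> g t = h t) ->
  (forall x y, (g x - h x) * (g y - h y) = 0) -> g =1 h.

Let subT : is_subgroup T.
Proof. by split=> //; rewrite -(subrr 1); exact: TB. Qed.

(** In S (x)_T S the ideal K of the diagonal is generated by the differences j(g_l) - i(g_l). Its
    p-th powers vanish since T contains all p-th powers of S. It is idempotent since modulo any
    ideal containing K^2 the two maps from S agree by [unram]. Hence K = 0, that is, x (x) 1 = 1 (x)
    x. *)
Lemma epimorphism (n : nat) (g : nat -> S) :
  (forall y, exists c : nat -> S, y = \sum_(i < n) c i ^+ p * g i) ->
  forall (V : zmodType) (beta : S -> S -> V),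
  balanced (fun a b => T a /\ a = b) beta -> forall x, beta x 1 = beta 1 x.
Proof.
move=> gen V beta bal x.
have [E [i [j [ijT _ univ]]]] := tensor_exists (fun a b : S => T a /\ a = b).
have ij t : T t -> i t = j t by move=> Tt; exact: ijT.
have charE : (p%:R : E) = 0 by rewrite -(rmorph_nat i) charS rmorph0.
pose K e := exists c : nat -> E, e = \sum_(l < n) c l * (j (g l) - i (g l)).
have idK : is_ideal K.
  split=> [|a y [c ->]]; last first.
    exists (fun l => a * c l).
    by rewrite mulr_sumr; apply: eq_bigr => l _; rewrite mulrA.
  split=> [|y z [c ->] [d ->]].
    by exists (fun=> 0); rewrite big1 // => l _; rewrite mul0r.
  exists (fun l => c l - d l).
  by rewrite -sumrB; apply: eq_bigr => l _; rewrite mulrBl.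
have Kij y : K (j y - i y).
  have [c ->] := gen y; exists (fun l => i (c l ^+ p)).
  rewrite !rmorph_sum -sumrB; apply: eq_bigr => l _.
  by rewrite !rmorphM mulrBr (ij (c l ^+ p)).
have Kpow k : K k -> k ^+ p = 0.
  move=> [c ->]; rewrite frobenius_sum // big1 // => l _.
  rewrite exprMn frobenius_sub // -!rmorphXn.
  by rewrite (ij (g l ^+ p)) // subrr mulr0.
have K0 : forall k, K k -> k = 0.
  pose d l := if (l < n)%N then j (g l) - i (g l) else 0.
  apply: (@nil_idempotent_ideal E K n d) => //.
  - by move=> k /Kpow k0; exists p.
  - move=> I idI KI k [c ->]; apply: (subgroup_sum idI) => l _.
    apply: (idealM idI).
    have [E' [q [_ qP]]] := ring_quotient idI.
    suff : (q \o j : {rmorphism S -> E'}) =1 (q \o i : {rmorphism S -> E'}).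
      by move=> /(_ (g l)) /eqP; rewrite -subr_eq0 /= -rmorphB => /eqP/qP.
    apply: unram => [t Tt|y z] /=; first by rewrite (ij t).
    by rewrite -!rmorphB -rmorphM; apply/qP/KI.
  - by move=> l; rewrite /d; case: ifP => // _; exact: (sub0 idK).
  - move=> k [c ->]; exists c; apply: eq_bigr => l _.
    by rewrite /d ltn_ord.
have Eij : \sum_(u <- [:: (x, 1); (-1, x)]) i u.1 * j u.2 = 0.
  rewrite !big_cons big_nil /= addr0 rmorphN !rmorph1 mulr1 mulN1r -opprB.
  by rewrite (K0 _ (Kij x)) oppr0.
have := univ V beta bal _ Eij; rewrite !big_cons big_nil /= addr0.
have -> : beta (-1) x = - beta 1 x.
  have := balancedBl bal 0 1 x; rewrite sub0r => ->.
  by have := balancedBl bal 0 0 x; rewrite !subrr => ->; rewrite sub0r.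
by move/eqP; rewrite subr_eq0 => /eqP.
Qed.

Lemma finite_epimorphism_surjective (n : nat) (g : nat -> S) :
  (forall y, exists c : nat -> S, y = \sum_(i < n) c i ^+ p * g i) -> forall s, T s.
Proof.
move=> gen; have epi := epimorphism gen.
(* Coefficients which were p-th powers are relaxed to elements of T, and 1 is adjoined as a
   generator, so that the induction can end at S = T. *)
have : forall y, exists t (c : nat -> S), [/\ T t, forall i, T (c i)
    & y = t + \sum_(i < n) c i * g i].
  move=> y; have [c ->] := gen y; exists 0, (fun i => c i ^+ p).
  by split=> //; [exact: (sub0 subT)|rewrite add0r].
elim: n {gen} => [|n IH] gen.
  by move=> s; have [t [c [Tt _ ->]]] := gen s; rewrite big_ord0 addr0.
pose M y := exists t (c : nat -> S),
  [/\ T t, forall i, T (c i) & y = t + \sum_(i < n) c i * g i].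
have subM : is_subgroup M.
  split=> [|y z [t [c [Tt Tc ->]]] [u [d [Tu Td ->]]]].
    exists 0, (fun=> 0); split=> [|_|]; rewrite ?big1 ?addr0 //; try exact: (sub0 subT).
    by move=> i _; rewrite mul0r.
  exists (t - u), (fun i => c i - d i); split=> [|i|]; try exact: TB.
  rewrite opprD addrACA -sumrB; congr (_ + _).
  by apply: eq_bigr => i _; rewrite mulrBl.
have MT a y : T a -> M y -> M (a * y).
  move=> Ta [t [c [Tt Tc ->]]]; exists (a * t), (fun i => a * c i).
  split=> [|i|]; try exact: TM.
  by rewrite mulrDr mulr_sumr; congr (_ + _); apply: eq_bigr => i _; rewrite mulrA.
pose m t := T t /\ M (t * g n).
have subm : is_subgroup m.
  split=> [|t u [Tt Mt] [Tu Mu]].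
    by split; [exact: (sub0 subT)|rewrite mul0r; exact: (sub0 subM)].
  by split; [exact: TB|rewrite mulrBl; exact: (subB subM)].
have mT a t : T a -> m t -> m (a * t).
  by move=> Ta [Tt Mt]; split; [exact: TM|rewrite -mulrA; exact: MT].
suff [_ Mgn] : m 1.
  apply: IH => y; have [t [c [Tt Tc ->]]] := gen y.
  rewrite big_ord_recr /= addrA; apply: (subgroupD subM).
    by exists t, c.
  by apply: MT => //; rewrite -[g n]mul1r.
(* [lam y] is the coefficient of [y] on [g n], an element of [T / m].         *)
have [lam lamP] : exists lam, forall y, T (lam y) /\ M (y - lam y * g n).
  apply: (choice_fun (Q := fun y l => T l /\ M (y - l * g n))) => y.
  have [t [c [Tt Tc ->]]] := gen y; exists (c n); split=> //.
  by rewrite big_ord_recr /= addrA addrK; exists t, c.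
have lam_uniq y l : T l -> M (y - l * g n) -> m (lam y - l).
  move=> Tl Ml; have [Tlam Mlam] := lamP y; split; first exact: TB.
  have -> : (lam y - l) * g n = (y - l * g n) - (y - lam y * g n) by ring.
  exact: (subB subM).
have [V [q [_ qP]]] := zmod_quotient (ideal_span_ideal m).
have qm x y : m (x - y) -> forall a, q (a * x) = q (a * y).
  move=> mxy a; apply/eqP; rewrite -subr_eq0 -raddfB -mulrBr; apply/eqP/qP.
  by apply: ideal_span_mul; exact: ideal_span_gen.
have bal : balanced (fun a b => T a /\ a = b) (fun x y => q (x * lam y)).
  split=> [a a' b|a b b'|a b [Ta <-] x y].
  - by rewrite mulrBl raddfB.
  - rewrite -raddfB -mulrBr; apply: qm; apply: lam_uniq.
      by apply: TB; exact: (lamP _).1.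
    have -> : b - b' - (lam b - lam b') * g n =
      (b - lam b * g n) - (b' - lam b' * g n) by ring.
    by apply: (subB subM); exact: (lamP _).2.
  - rewrite [a * x]mulrC -mulrA; apply: qm; rewrite -opprB.
    apply: (subgroupN subm); apply: lam_uniq.
      by apply: TM => //; exact: (lamP _).1.
    by rewrite -mulrA -mulrBr; apply: MT => //; exact: (lamP _).2.
have M1 : M 1.
  exists 1, (fun=> 0); split=> // [_|]; first exact: (sub0 subT).
  by rewrite big1 ?addr0 // => i _; rewrite mul0r.
have := epi V _ bal (g n); rewrite (qm (lam 1) 0); last first.
  by apply: lam_uniq; [exact: (sub0 subT)|rewrite mul0r subr0].
rewrite (qm (lam (g n)) 1); last first.
  by apply: lam_uniq => //; rewrite mul1r subrr; exact: (sub0 subM).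
rewrite mulr0 mulr1 raddf0 => /esym/qP m1.
(* Frobenius sends S into T, hence mS into m; it is applied to 1. *)
have mp x : ideal_span m x -> m (x ^+ p).
  elim=> [|a u y mu _ my]; first by rewrite frobenius0 //; exact: (sub0 subm).
  rewrite frobenius_add // exprMn; apply: (subgroupD subm) => //.
  have -> : a ^+ p * u ^+ p = a ^+ p * u ^+ p.-1 * u.
    by rewrite -mulrA -exprSr prednK // prime_gt0.
  apply: mT => //; apply: TM => //; elim: p.-1 => [|k IHk]; first by rewrite expr0.
  by rewrite exprS; apply: TM => //; exact: mu.1.
by have := mp 1 m1; rewrite expr1n.
Qed.
End FiniteEpimorphism.

(** * Noetherian modules *)

Record is_submodule (A : comPzRingType) (n : nat) (U : 'cV[A]_n -> Prop) : Prop :=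
  IsSubmodule { submod_sub :> is_subgroup U;
                submodZ : forall a x, U x -> U (a *: x) }.

Section NoetherianModules.
Context (A : comPzRingType) (noethA : noetherian_ring A).

Lemma fg_ideal (I : A -> Prop) : is_ideal I ->
  exists k (g : 'rV[A]_k), forall x, I x <-> exists c : 'cV_k, x = (g *m c) 0 0.
Proof.
move=> idI; have [|x y Ix Iy|a x Ix|k [g gP]] := noethA (I := I).
- exact: (sub0 idI).
- exact: (subgroupD idI).
- exact: (idealM idI).
exists k, (\row_i g i) => x; split=> [/gP [c ->]|[c ->]].
  exists (\col_i c i); rewrite mxE; apply: eq_bigr => i _.
  by rewrite !mxE mulrC.
apply/gP; exists (fun i => c i 0); rewrite mxE; apply: eq_bigr => i _.
by rewrite !mxE mulrC.
Qed.

(** The first coordinates of U form an ideal, with generators [g] lifted to U by [Y]; the vectors of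
    U with zero first coordinate are handled by induction. Together they form a block triangular
    generating matrix. *)
Lemma fg_submodule n (U : 'cV[A]_n -> Prop) : is_submodule U ->
  exists k (G : 'M[A]_(n, k)), forall x, U x <-> exists c, x = G *m c.
Proof.
elim: n U => [|n IH] U subU.
  exists 0, 0 => x; split=> [_|[c ->]].
    by exists 0; rewrite [x]flatmx0 [RHS]flatmx0.
  by rewrite mul0mx; exact: (sub0 subU).
pose I (a : A) := exists y : 'cV_n, U (col_mx a%:M y : 'cV_(1 + n)).
have idI : is_ideal I.
  split=> [|a x [y Uy]]; last first.
    by exists (a *: y); rewrite -scale_scalar_mx -scale_col_mx; exact: (submodZ subU).
  split=> [|x y [u Uu] [v Uv]].
    by exists 0; rewrite raddf0 col_mx0; exact: (sub0 subU).
  exists (u - v); rewrite raddfB /= -add_col_mx -opp_col_mx.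
  exact: (subB subU).
have [k [g gP]] := fg_ideal idI.
have [Y YP] : exists Y : 'I_k -> 'cV[A]_n,
    forall i, U (col_mx (g 0 i)%:M (Y i) : 'cV_(1 + n)).
  apply: (choice_fun (Q := fun i y => U (col_mx (g 0 i)%:M y : 'cV_(1 + n)))) => i.
  apply/gP; exists (delta_mx i 0); rewrite mxE (bigD1 i) //= mxE !eqxx mulr1.
  by rewrite big1 ?addr0 // => j /negPf ji; rewrite mxE ji mulr0.
have subU' : is_submodule (fun y : 'cV_n => U (col_mx 0 y : 'cV_(1 + n))).
  split=> [|a y Uy]; last first.
    by rewrite -[X in col_mx X](scaler0 _ a) -scale_col_mx; exact: (submodZ subU).
  split=> [|x y Ux Uy]; first by rewrite col_mx0; exact: (sub0 subU).
  rewrite -[X in col_mx X](subrr 0) -add_col_mx -opp_col_mx.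
  exact: (subB subU).
have [k' [G GP]] := IH _ subU'.
pose Ym : 'M[A]_(n, k) := \matrix_(i, j) Y j i 0.
have UY (c : 'cV_k) : U (col_mx (g *m c) (Ym *m c) : 'cV_(1 + n)).
  have -> : col_mx (g *m c) (Ym *m c) =
      \sum_j c j 0 *: col_mx (g 0 j)%:M (Y j) :> 'cV_(1 + n).
    apply/colP => i; rewrite summxE -[i]splitK; case: (split i) => [l|l] /=.
      rewrite col_mxEu ord1 mxE; apply: eq_bigr => j _.
      by rewrite [RHS]mxE col_mxEu !mxE mulr1n mulrC.
    rewrite col_mxEd mxE; apply: eq_bigr => j _.
    by rewrite [RHS]mxE col_mxEd !mxE mulrC.
  by apply: (subgroup_sum subU) => j _; apply: (submodZ subU).
exists (k + k')%N, (block_mx g 0 Ym G : 'M_(1 + n, _)) => x; split=> [Ux|[c ->]].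
  have /gP [c cE] : I (x 0 0).
    exists (dsubmx (x : 'cV_(1 + n))).
    suff -> : (x 0 0)%:M = usubmx (x : 'cV_(1 + n)) by rewrite vsubmxK.
    by apply/colP => i; rewrite !mxE ord1 eqxx mulr1n; congr (x _ 0); apply: val_inj.
  have gc : usubmx (x : 'cV_(1 + n)) = g *m c.
    apply/colP => i; rewrite ord1 -cE !mxE; congr (x _ 0); exact: val_inj.
  have /GP [d dE] : U (col_mx 0 (dsubmx (x : 'cV_(1 + n)) - Ym *m c) : 'cV_(1 + n)).
    have -> : col_mx 0 (dsubmx (x : 'cV_(1 + n)) - Ym *m c) =
        (x : 'cV_(1 + n)) - col_mx (g *m c) (Ym *m c) :> 'cV_(1 + n).
      by rewrite -{2}[x](@vsubmxK _ 1 n) opp_col_mx add_col_mx gc subrr.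
    exact: (subB subU).
  exists (col_mx c d).
  rewrite (mul_block_col g 0 Ym G c d) mul0mx addr0 -dE addrC subrK -gc.
  by rewrite vsubmxK.
rewrite -[c]vsubmxK (mul_block_col g 0 Ym G) mul0mx addr0.
rewrite -[g *m _]addr0 -add_col_mx; apply: (subgroupD subU); first exact: UY.
by apply/GP; exists (dsubmx c).
Qed.
End NoetherianModules.

(** * Bijectivity of the relative Frobenius *)

Lemma quotient_lift (A B E : comPzRingType) (q : {rmorphism A -> E})
    (g : {rmorphism A -> B}) :
  (forall e, exists x, q x = e) -> (forall x, q x = 0 -> g x = 0) ->
  exists h : {rmorphism E -> B}, forall x, h (q x) = g x.
Proof.
move=> q_surj qg; have [r rK] := choice_fun q_surj.
have gE x y : q x = q y -> g x = g y.
  move=> /eqP; rewrite -subr_eq0 -rmorphB => /eqP/qg; rewrite rmorphB.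
  by move=> /eqP; rewrite subr_eq0 => /eqP.
have hq x : g (r (q x)) = g x by exact: gE.
have hB : zmod_morphism (fun e => g (r e)).
  by move=> x y; rewrite -rmorphB; apply: gE; rewrite rmorphB !rK.
have hM : monoid_morphism (fun e => g (r e)).
  split=> [|x y]; first by rewrite -(rmorph1 q) hq rmorph1.
  by rewrite -rmorphM; apply: gE; rewrite rmorphM !rK.
by exists (mk_rmorphism hB hM).
Qed.

Lemma tensor_lift (A B E D : comPzRingType) (i : {rmorphism A -> E})
    (j : {rmorphism B -> E}) (g : {rmorphism A -> D}) (h : {rmorphism B -> D}) :
  (forall e, exists s : seq (A * B), e = \sum_(u <- s) i u.1 * j u.2) ->
  (forall s : seq (A * B), \sum_(u <- s) i u.1 * j u.2 = 0 ->
    \sum_(u <- s) g u.1 * h u.2 = 0) ->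
  exists rho : {rmorphism E -> D},
    (forall a, rho (i a) = g a) /\ (forall b, rho (j b) = h b).
Proof.
move=> span univ; have [s sP] := choice_fun span.
pose T (t : seq (A * B)) := \sum_(u <- t) i u.1 * j u.2.
pose G (t : seq (A * B)) := \sum_(u <- t) g u.1 * h u.2.
pose N (t : seq (A * B)) := [seq (- u.1, u.2) | u <- t].
have Tcat t t' : T (t ++ t') = T t + T t' by exact: big_cat.
have Gcat t t' : G (t ++ t') = G t + G t' by exact: big_cat.
have TN t : T (N t) = - T t.
  by rewrite /T big_map -sumrN; apply: eq_bigr => u _; rewrite rmorphN mulNr.
have GN t : G (N t) = - G t.
  by rewrite /G big_map -sumrN; apply: eq_bigr => u _; rewrite rmorphN mulNr.
have GT t t' : T t = T t' -> G t = G t'.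
  move=> tt'; apply/eqP; rewrite -subr_eq0 -GN -Gcat; apply/eqP/univ.
  by rewrite -[LHS]/(T _) Tcat TN tt' subrr.
have sT e : T (s e) = e by exact: (esym (sP e)).
pose rho e := G (s e).
have rhoT t : rho (T t) = G t by apply: GT; exact: sT.
have rhoB : zmod_morphism rho.
  move=> x y; rewrite /rho -GN -Gcat; apply: GT.
  by rewrite Tcat TN !sT.
have rho_ij a b : rho (i a * j b) = g a * h b.
  have <- : T [:: (a, b)] = i a * j b by rewrite /T big_seq1.
  by rewrite rhoT /G big_seq1.
pose P (t t' : seq (A * B)) := [seq (u.1 * v.1, u.2 * v.2) | u <- t, v <- t'].
have TP t t' : T (P t t') = T t * T t'.
  rewrite /T big_distrlr big_allpairs_dep; apply: eq_bigr => u _.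
  by apply: eq_bigr => v _; rewrite !rmorphM mulrACA.
have GP t t' : G (P t t') = G t * G t'.
  rewrite /G big_distrlr big_allpairs_dep; apply: eq_bigr => u _.
  by apply: eq_bigr => v _; rewrite !rmorphM mulrACA.
have rhoM : monoid_morphism rho.
  split=> [|x y]; first by have := rho_ij 1 1; rewrite !rmorph1 !mulr1.
  by rewrite -{1}(sT x) -{1}(sT y) -TP rhoT GP.
exists (mk_rmorphism rhoB rhoM); split=> [a|b] /=.
  by rewrite -[i a]mulr1 -(rmorph1 j) rho_ij rmorph1 mulr1.
by rewrite -[j b]mul1r -(rmorph1 i) rho_ij rmorph1 mul1r.
Qed.

Section RelativeFrobenius.
Context (p : nat) (R S : comPzRingType) (f : {rmorphism R -> S}).
Context (p_prime : prime p) (charR : (p%:R : R) = 0) (charS : (p%:R : S) = 0).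
Context (N : nat) (r : 'I_N -> R).
Hypothesis r_gen : forall y, exists c : 'I_N -> R, y = \sum_i c i ^+ p * r i.
Hypothesis unram : forall (E : comPzRingType) (g h : {rmorphism S -> E}),
  (forall a, g (f a) = h (f a)) ->
  (forall x y, (g x - h x) * (g y - h y) = 0) -> g =1 h.

(* [balanced frob_rel] maps out of [R * S] are maps out of [S (x)_(R,F) R].   *)
Definition frob_rel (a : R) (b : S) := exists c, a = c ^+ p /\ b = f c.

(** Here E is R (x) S over R, with Frobenius on the first factor. Surjectivity of [rho] is
    [finite_epimorphism_surjective] for T its image, which contains f(R) and all p-th powers. *)
Lemma relative_frobenius_ring : finite_ring_map (fun x : S => x ^+ p) ->
  exists (E : comPzRingType) (i : {rmorphism R -> E}) (j : {rmorphism S -> E})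
    (rho : {rmorphism E -> S}),
  [/\ forall a b, frob_rel a b -> i a = j b,
      forall e, exists s : seq (R * S), e = \sum_(u <- s) i u.1 * j u.2,
      forall (V : zmodType) (beta : R -> S -> V), balanced frob_rel beta ->
        forall s : seq (R * S), \sum_(u <- s) i u.1 * j u.2 = 0 ->
        \sum_(u <- s) beta u.1 u.2 = 0
    & [/\ forall a, rho (i a) = f a, forall b, rho (j b) = b ^+ p
        & forall s, exists e, rho e = s]].
Proof.
move=> [n [g g_gen]].
have [E [i [j [ij span univ]]]] := tensor_exists frob_rel.
pose FS := frobenius p_prime charS.
have [|rho [rho_i rho_j]] := tensor_lift (g := f) (h := FS) span.
  apply: (univ S (fun a b => f a * FS b)); split=> [a a' b|a b b'|a b [c [-> ->]] x y].
  - by rewrite rmorphB mulrBl.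
  - by rewrite rmorphB mulrBr.
  - by rewrite !rmorphM /= rmorphXn mulrCA mulrA.
exists E, i, j, rho; split=> //; split=> //.
pose ext (d : 'I_n -> S) l := if insub l is Some k then d k else 0.
have extE (d : 'I_n -> S) (l : 'I_n) : ext d l = d l by rewrite /ext valK.
apply: (@finite_epimorphism_surjective p S p_prime charS
  (fun s => exists e, rho e = s) _ _ _ _ _ n (ext g)).
- by exists 1; rewrite rmorph1.
- by move=> x y [d <-] [e <-]; exists (d - e); rewrite rmorphB.
- by move=> x y [d <-] [e <-]; exists (d * e); rewrite rmorphM.
- by move=> x; exists (j x); rewrite rho_j.
- move=> D g' h' gh; apply: unram => a; apply: gh.
  by exists (i a); rewrite rho_i.
- move=> y; have [c ->] := g_gen y.
  exists (ext c); apply: eq_bigr => l _; by rewrite !extE.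
Qed.

Hypothesis smooth : forall (E : comPzRingType) (pi : {rmorphism E -> S})
  (iota : {rmorphism R -> E}),
  (forall a, pi (iota a) = f a) -> (forall s, exists e, pi e = s) ->
  (forall x y, pi x = 0 -> pi y = 0 -> x * y = 0) ->
  exists sigma : {rmorphism S -> E}, (forall s, pi (sigma s) = s) /\
    (forall a, sigma (f a) = iota a).
Hypothesis noethS : noetherian_ring S.

Section Injectivity.
Context (E : comPzRingType) (i : {rmorphism R -> E}) (j : {rmorphism S -> E}).
Context (rho : {rmorphism E -> S}).
Hypothesis ij : forall c, i (c ^+ p) = j (f c).
Hypothesis span : forall e, exists s : seq (R * S),
  e = \sum_(u <- s) i u.1 * j u.2.
Hypothesis rho_i : forall a, rho (i a) = f a.
Hypothesis rho_j : forall b, rho (j b) = b ^+ p.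
Hypothesis rho_surj : forall s, exists e, rho e = s.

(** E is generated as an S-module by the images of the generators of R over its p-th powers, so it
    is a quotient of S^N. *)
Lemma frob_normal_form e : exists y : 'cV[S]_N, e = \sum_h i (r h) * j (y h 0).
Proof.
have [s ->] := span e; elim: s => [|u s [y IH]].
  exists 0; rewrite big_nil big1 // => h _.
  by rewrite mxE rmorph0 mulr0.
have [c cE] := r_gen u.1.
exists (\col_h (f (c h) * u.2 + y h 0)); rewrite big_cons IH {1}cE.
rewrite rmorph_sum mulr_suml -big_split; apply: eq_bigr => h _.
rewrite mxE rmorphD !rmorphM ij mulrDr /=; congr (_ + _).
by rewrite [j _ * i _]mulrC mulrA.
Qed.

(** Frobenius of E factors through [rho], so the kernel of [rho] is nil. *)
Lemma frob_pow e : e ^+ p = j (rho e).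
Proof.
have charE : (p%:R : E) = 0 by rewrite -(rmorph_nat i) charR rmorph0.
have [s ->] := span e; rewrite frobenius_sum // !rmorph_sum.
apply: eq_bigr => u _.
rewrite exprMn -(rmorphXn i) -(rmorphXn j) ij (rmorphM rho) rho_i rho_j.
by rewrite rmorphM.
Qed.

(** The kernel K is finitely generated because its preimage in S^N is. For idempotence, a section
    [sigma] of a square-zero quotient of E over S satisfies q = sigma o rho, so q kills K. *)
Lemma rho_injective e : rho e = 0 -> e = 0.
Proof.
pose K e := rho e = 0.
have idK : is_ideal K.
  split=> [|a x]; last by rewrite /K rmorphM => ->; rewrite mulr0.
  by split=> [|x y]; rewrite /K ?rmorph0 ?rmorphB // => -> ->; rewrite subrr.
pose U (y : 'cV[S]_N) := K (\sum_h i (r h) * j (y h 0)).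
have subU : is_submodule U.
  split=> [|s y Uy].
    split=> [|x y Ux Uy].
      rewrite /U big1; first exact: (sub0 idK).
      by move=> h _; rewrite mxE rmorph0 mulr0.
    suff -> : U (x - y) = K (\sum_h i (r h) * j (x h 0) -
        \sum_h i (r h) * j (y h 0)) by exact: (subB idK).
    rewrite /U -sumrB; congr K; apply: eq_bigr => h _.
    by rewrite !mxE rmorphB mulrBr.
  suff -> : U (s *: y) = K (j s * \sum_h i (r h) * j (y h 0)).
    exact: (idealM idK).
  rewrite /U mulr_sumr; congr K; apply: eq_bigr => h _.
  by rewrite !mxE rmorphM mulrCA.
have [k [G GP]] := fg_submodule noethS subU.
pose x (l : 'I_k) := \sum_h i (r h) * j (G h l).
pose x' l := if insub l is Some l' then x l' else 0.
have x'E (l : 'I_k) : x' l = x l by rewrite /x' valK.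
have Kx l : K (x l).
  have : U (G *m delta_mx l 0) by apply/GP; exists (delta_mx l 0).
  by rewrite -colE /U; under eq_bigr do rewrite mxE.
apply: (@nil_idempotent_ideal E K k x') => //.
- by move=> y Ky; exists p; rewrite frob_pow Ky rmorph0.
- move=> I idI KI y Ky.
  (* The quotient is by the intersection of I and K: it still contains K^2, and [rho] descends to
     it. *)
  have idIK : is_ideal (fun z => I z /\ K z).
    split=> [|a z [Iz Kz]]; last first.
      by split; [exact: (idealM idI)|exact: (idealM idK)].
    split=> [|z w [Iz Kz] [Iw Kw]].
      by split; [exact: (sub0 idI)|exact: (sub0 idK)].
    by split; [exact: (subB idI)|exact: (subB idK)].
  have [E' [q [q_surj qP]]] := ring_quotient idIK.
  have [|pi piq] := quotient_lift (g := rho) q_surj; first by move=> z /qP [].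
  have pi_sq0 a b : pi a = 0 -> pi b = 0 -> a * b = 0.
    have [a' <-] := q_surj a; have [b' <-] := q_surj b.
    rewrite !piq => Ka Kb; rewrite -rmorphM; apply/qP; split; first exact: KI.
    exact: (idealM idK).
  have [||//|sigma [sigmaK sigmaC]] := smooth (pi := pi) (iota := q \o i).
  - by move=> a /=; rewrite piq rho_i.
  - by move=> s; have [e' <-] := rho_surj s; exists (q e'); rewrite piq.
  (* Both sides are ring maps in s that agree on R and become equal in S, hence coincide by
     unramifiedness. *)
  have qj s : q (j s) = sigma (s ^+ p).
    apply: (unram (g := q \o j) (h := sigma \o frobenius p_prime charS)) => [a|a b].
      by rewrite /= -(rmorphXn f) sigmaC /= ij.
    apply: pi_sq0; rewrite /= rmorphB sigmaK piq rho_j subrr //.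
  apply: (proj1 (iffLR (qP y) _)).
  have [s sE] := span y.
  have <- : sigma (rho y) = 0 by rewrite Ky rmorph0.
  rewrite sE !rmorph_sum; apply: eq_bigr => u _.
  by rewrite !rmorphM rho_i rho_j sigmaC /= qj.
- by move=> l; rewrite /x'; case: insubP => // _; exact: (sub0 idK).
move=> e' Ke'; have [y yE] := frob_normal_form e'.
have /GP [c cE] : U y by rewrite /U -yE.
exists (fun l => if insub l is Some l' then j (c l' 0) else 0).
rewrite yE cE; under [RHS]eq_bigr do rewrite x'E valK mulr_sumr.
rewrite exchange_big /=; apply: eq_bigr => h _.
rewrite mxE rmorph_sum mulr_sumr; apply: eq_bigr => l _.
by rewrite rmorphM mulrA [RHS]mulrC -mulrA.
Qed.
End Injectivity.

Hypothesis finS : finite_ring_map (fun x : S => x ^+ p).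

Theorem relative_frobenius_iso :
  (forall s, exists y : 'I_N -> S, s = \sum_h f (r h) * y h ^+ p) /\
  (forall (V : zmodType) (beta : R -> S -> V), balanced frob_rel beta ->
    forall y : 'I_N -> S, \sum_h f (r h) * y h ^+ p = 0 ->
    \sum_h beta (r h) (y h) = 0).
Proof.
have [E [i [j [rho [ij span univ [rho_i rho_j rho_surj]]]]]] :=
  relative_frobenius_ring finS.
have ij' c : i (c ^+ p) = j (f c) by apply: ij; exists c.
split=> [s|V beta bal y y0].
  have [e <-] := rho_surj s; have [y ->] := frob_normal_form ij' span e.
  exists (fun h => y h 0); rewrite rmorph_sum; apply: eq_bigr => h _.
  by rewrite rmorphM rho_i rho_j.
have := univ V beta bal [seq (r h, y h) | h <- index_enum 'I_N].
rewrite !big_map; apply; apply: (rho_injective ij' span rho_i rho_j rho_surj).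
rewrite rmorph_sum -[RHS]y0; apply: eq_bigr => h _.
by rewrite rmorphM rho_i rho_j.
Qed.

(** The relations among the r_h after base change to S come from relations over R. Modulo the
    submodule [U] of such vectors, sending (a, s) to s times the coordinates of a is independent of
    the coordinates and balanced; injectivity of the relative Frobenius applies to it. *)
Lemma frobenius_relations (y : 'cV[S]_N) : \sum_h f (r h) * y h 0 ^+ p = 0 ->
  exists k (A : 'M[R]_(N, k)) (z : 'cV[S]_k),
    y = map_mx f A *m z /\ forall g, \sum_h A h g ^+ p * r h = 0.
Proof.
pose U (y : 'cV[S]_N) := exists k (A : 'M[R]_(N, k)) (z : 'cV[S]_k),
    y = map_mx f A *m z /\ forall g, \sum_h A h g ^+ p * r h = 0.
move=> y0; rewrite -/(U y).
have subU : is_subgroup U.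
  split=> [|y1 y2 [k1 [A1 [z1 [-> A1r]]]] [k2 [A2 [z2 [-> A2r]]]]].
    by exists 0, 0, 0; rewrite mulmx0; split=> // [[]].
  exists (k1 + k2)%N, (row_mx A1 A2), (col_mx z1 (- z2)); split.
    by rewrite map_row_mx mul_row_col mulmxN.
  move=> g; rewrite -[g]splitK; case: (split g) => l /=.
    by under eq_bigr do rewrite row_mxEl.
  by under eq_bigr do rewrite row_mxEr.
have U1 (A : 'I_N -> R) (s : S) : \sum_h A h ^+ p * r h = 0 ->
    U (\col_h (f (A h) * s)).
  move=> Ar; exists 1, (\col_h A h), s%:M; split.
    by apply/colP => h; rewrite !mxE big_ord1 !mxE eqxx mulr1n.
  by move=> g; under eq_bigr do rewrite mxE.
have [co coE] := choice_fun r_gen.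
have [V [q [_ qP]]] := zmod_quotient subU.
have qE x x' : U (x - x') -> q x = q x'.
  by move=> /qP; rewrite raddfB => /eqP; rewrite subr_eq0 => /eqP.
pose beta a s := q (\col_h (f (co a h) * s)).
have bal : balanced frob_rel beta.
  split=> [a a' b|a b b'|_ _ [c [-> ->]] a s].
  - rewrite -raddfB; apply: qE.
    have -> : \col_h (f (co (a - a') h) * b) - (\col_h (f (co a h) * b) -
      \col_h (f (co a' h) * b)) =
      \col_h (f (co (a - a') h - (co a h - co a' h)) * b).
      by apply/colP => h; rewrite !mxE !rmorphB !mulrBl.
    apply: U1; under eq_bigr do rewrite !(frobenius_sub p_prime charR) !mulrBl.
    by rewrite !sumrB -!coE subrr.
  - rewrite -raddfB; congr (q _); apply/colP => h.
    by rewrite !mxE mulrBr.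
  - apply: qE.
    have -> : \col_h (f (co (c ^+ p * a) h) * s) - \col_h (f (co a h) * (f c * s)) =
      \col_h (f (co (c ^+ p * a) h - c * co a h) * s).
      apply/colP => h; rewrite !mxE rmorphB rmorphM mulrBl.
      by rewrite [f c * f _]mulrC -mulrA.
    apply: U1.
    under eq_bigr do rewrite (frobenius_sub p_prime charR) exprMn mulrBl -mulrA.
    by rewrite sumrB -coE -mulr_sumr -coE subrr.
have := relative_frobenius_iso.2 V beta bal (fun h => y h 0) y0.
rewrite -raddf_sum => /qP Uy.
rewrite -[y](subrK (\sum_h \col_h' (f (co (r h) h') * y h 0))).
apply: (subgroupD subU) => //.
have -> : y - \sum_h \col_h' (f (co (r h) h') * y h 0) =
  \sum_h \col_h' (f ((h == h')%:R - co (r h) h') * y h 0).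
  apply/colP => h'; rewrite !mxE !summxE.
  under [RHS]eq_bigr do rewrite mxE rmorphB mulrBl.
  under [X in _ - X = _]eq_bigr do rewrite mxE.
  rewrite sumrB; congr (_ - _); rewrite (bigD1 h') //= eqxx rmorph1 mul1r.
  by rewrite big1 ?addr0 // => h /negPf ->; rewrite rmorph0 mul0r.
apply: (subgroup_sum subU) => h _; apply: U1.
under eq_bigr do rewrite (frobenius_sub p_prime charR) mulrBl.
rewrite sumrB -coE (bigD1 h) //= eqxx expr1n mul1r big1 ?addr0 ?subrr //.
move=> h' /negPf hh'; rewrite eq_sym hh' frobenius0 // mul0r //.
Qed.
End RelativeFrobenius.

(** * Flatness *)

Section ArtinRees.
Context (A : comPzRingType) (noethA : noetherian_ring A) (n : nat).
Implicit Types (L N : 'cV[A]_n -> Prop).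

Lemma submodule_acc (U : nat -> 'cV[A]_n -> Prop) :
  (forall k, is_submodule (U k)) -> (forall k x, U k x -> U k.+1 x) ->
  exists k, forall j x, U j x -> U k x.
Proof.
move=> subU incU.
have leU j k x : (j <= k)%N -> U j x -> U k x.
  move=> /subnK <-; elim: (k - j)%N => [//|d IH] Ux.
  by rewrite addSn; apply/incU/IH.
pose V x := exists k, U k x.
have subV : is_submodule V.
  split=> [|a x [k Uk]]; last by exists k; exact: (submodZ (subU k)).
  split=> [|x y [j Uj] [k Uk]]; first by exists 0%N; exact: (sub0 (subU _)).
  exists (maxn j k); apply: (subB (subU _)).
    by apply: leU Uj; exact: leq_maxl.
  by apply: leU Uk; exact: leq_maxr.
have [m [G GP]] := fg_submodule noethA subV.
have [d dP] : exists d : 'I_m -> nat, forall l, U (d l) (col l G).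
  apply: (choice_fun (Q := fun l d => U d (col l G))) => l.
  by apply/GP; exists (delta_mx l 0); rewrite colE.
exists (\max_l d l) => j x Ux; have /GP [c ->] : V x by exists j.
have -> : G *m c = \sum_l c l 0 *: col l G.
  apply/colP => i; rewrite mxE summxE; apply: eq_bigr => l _.
  by rewrite !mxE mulrC.
apply: (subgroup_sum (subU _)) => l _; apply: (submodZ (subU _)).
exact: leU (leq_bigmax l) (dP l).
Qed.

(** The submodules of x with g^k x in L become stationary at some k. If l + g^k x lies in N, then
    g^(c + k) x lies in L, hence already g^k x does. *)
Lemma artin_rees1 (g : A) L N : is_submodule L ->
  (exists c, forall y, N y -> L (g ^+ c *: y)) ->
  exists k, forall l x, L l -> N (l + g ^+ k *: x) -> L (l + g ^+ k *: x).
Proof.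
move=> subL [c gNL].
have [||k kP] := submodule_acc (U := fun k x => L (g ^+ k *: x)).
- move=> k; split=> [|a x Lx].
    split=> [|x y Lx Ly]; first by rewrite scaler0; exact: (sub0 subL).
    by rewrite scalerBr; exact: (subB subL).
  by rewrite scalerA mulrC -scalerA; exact: (submodZ subL).
- by move=> k x; rewrite exprS -scalerA; exact: (submodZ subL).
exists k => l x Ll Ny; apply: (subgroupD subL) => //.
apply: (kP (c + k)%N); rewrite exprD -scalerA.
have -> : g ^+ c *: (g ^+ k *: x) = g ^+ c *: (l + g ^+ k *: x) - g ^+ c *: l.
  by rewrite scalerDr addrAC subrr add0r.
by apply: (subB subL); [exact: gNL | exact: (submodZ subL)].
Qed.

(* A weak form of the Artin-Rees lemma, with powers of generators in place of *)
(* powers of the ideal they generate.                                         *)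
Lemma artin_rees (gs : seq A) L N : is_submodule L ->
  (forall g, g \in gs -> exists c, forall y, N y -> L (g ^+ c *: y)) ->
  exists L' : 'cV[A]_n -> Prop, [/\ is_submodule L', forall x, L x -> L' x,
    forall y, N y -> L' y -> L y
  & exists k0, forall k, (k0 <= k)%N -> forall g x, g \in gs -> L' (g ^+ k *: x)].
Proof.
move=> subL; elim: gs => [|g gs IH] gNL; first by exists L; split=> //; exists 0%N.
have [|L' [subL' LL' L'N [k0 k0P]]] := IH.
  by move=> h hgs; apply: gNL; rewrite inE hgs orbT.
have [|k kP] := @artin_rees1 g L' N subL'.
  have [|c cP] := gNL g; first by rewrite inE eqxx.
  by exists c => y /cP /LL'.
exists (fun y => exists l x, L' l /\ y = l + g ^+ k *: x); split.
- split=> [|a _ [l [x [Ll ->]]]]; last first.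
    exists (a *: l), (a *: x); split; first exact: (submodZ subL').
    by rewrite scalerDr !scalerA mulrC.
  split=> [|_ _ [l [x [Ll ->]]] [m [y [Lm ->]]]].
    by exists 0, 0; split; [exact: (sub0 subL')|rewrite scaler0 addr0].
  exists (l - m), (x - y); split; first exact: (subB subL').
  by rewrite scalerBr opprD addrACA.
- by move=> x /LL' Lx; exists x, 0; rewrite scaler0 addr0.
- move=> y Ny [l [x [Ll yE]]]; apply: L'N => //.
  by rewrite yE in Ny *; exact: kP.
exists (maxn k0 k) => j; rewrite geq_max => /andP[k0j kj] h x.
rewrite inE => /orP[/eqP ->|hgs].
  exists 0, (g ^+ (j - k) *: x); split; first exact: (sub0 subL').
  by rewrite add0r scalerA -exprD subnKC.
exists (h ^+ j *: x), 0; split; first exact: k0P.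
by rewrite scaler0 addr0.
Qed.
End ArtinRees.

(** A counterexample would yield a strictly ascending chain of ideals by choice, contradicting
    [submodule_acc] for submodules of R^1. *)
Lemma noetherian_ind (R : comPzRingType) (noethR : noetherian_ring R)
    (Pr : (R -> Prop) -> Prop) :
  (forall J, is_ideal J -> (forall J', is_ideal J' -> (forall x, J x -> J' x) ->
    ~ (forall x, J' x -> J x) -> Pr J') -> Pr J) ->
  forall J, is_ideal J -> Pr J.
Proof.
move=> step J idJ; have [//|badJ] := classic (Pr J); exfalso.
pose T := {I : R -> Prop | is_ideal I /\ ~ Pr I}.
have [next nextP] : exists next : T -> T, forall I,
    (forall x, sval I x -> sval (next I) x) /\
    ~ (forall x, sval (next I) x -> sval I x).
  apply: (choice_fun (Q := fun I I' : T => (forall x, sval I x -> sval I' x) /\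
    ~ (forall x, sval I' x -> sval I x))) => -[I [idI badI]] /=.
  apply: NNPP => no; apply: badI; apply: step => // I' idI' II' nI'I.
  by apply: NNPP => badI'; apply: no; exists (exist _ I' (conj idI' badI')).
pose c k := iter k next (exist _ J (conj idJ badJ)).
have subc k : is_submodule (fun x : 'cV[R]_1 => sval (c k) (x 0 0)).
  case: (c k) => I [idI _] /=; split=> [|a x Ix].
    split=> [|x y Ix Iy]; first by rewrite mxE; exact: (sub0 idI).
    by rewrite !mxE; exact: (subB idI).
  by rewrite mxE; exact: (idealM idI).
have [|k kP] := submodule_acc noethR subc.
  by move=> k x; exact: (nextP (c k)).1.
apply: (nextP (c k)).2 => x; have := kP k.+1 (x%:M).
by rewrite mxE eqxx mulr1n.
Qed.

(** * The equational criterion *)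

Section Flatness.
Context (R S : comPzRingType) (f : {rmorphism R -> S}).

Definition ext_ideal (J : R -> Prop) : S -> Prop :=
  ideal_span (fun x => exists2 b, J b & x = f b).

(* The equational criterion for S / JS to be flat over R / J.                 *)
Definition flat_mod (J : R -> Prop) : Prop :=
  forall (I : finType) (a : I -> R) (s : I -> S),
  ext_ideal J (\sum_i f (a i) * s i) ->
  exists (K : finType) (B : I -> K -> R) (v : K -> S),
    (forall i, s i = \sum_k f (B i k) * v k) /\
    (forall k, J (\sum_i a i * B i k)).

Lemma ideal_span_sum (A : comPzRingType) (G : A -> Prop) x : ideal_span G x ->
  exists n (g t : 'I_n -> A), (forall l, G (g l)) /\ x = \sum_l t l * g l.
Proof.
elim=> [|a g y Gg _ [n [h [t [Gh ->]]]]].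
  by exists 0%N, (fun=> 0), (fun=> 0); split=> [[]|]; rewrite ?big_ord0.
exists n.+1, (fun l => if unlift ord0 l is Some l' then h l' else g),
  (fun l => if unlift ord0 l is Some l' then t l' else a); split.
  by move=> l; case: unliftP.
rewrite big_ord_recl unlift_none addrC; congr (_ + _).
by apply: eq_bigr => l _; rewrite liftK.
Qed.

(** The relations are trivialised one after the other: each next one is rewritten in the vectors [v]
    found so far. *)
Lemma flat_mod_system (J : R -> Prop) : is_ideal J -> flat_mod J ->
  forall (T : eqType) (rows : seq T) (I : finType) (A : T -> I -> R) (s : I -> S),
  (forall t, t \in rows -> ext_ideal J (\sum_i f (A t i) * s i)) ->
  exists (K : finType) (B : I -> K -> R) (v : K -> S),
    (forall i, s i = \sum_k f (B i k) * v k) /\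
    (forall t k, t \in rows -> J (\sum_i A t i * B i k)).
Proof.
move=> idJ flatJ T; elim=> [|t rows IH] I A s As.
  exists I, (fun i k => (i == k)%:R), s; split=> // i.
  rewrite (bigD1 i) //= eqxx rmorph1 mul1r big1 ?addr0 // => k /negPf ki.
  by rewrite eq_sym ki rmorph0 mul0r.
have [|K [B [v [sE AB]]]] := IH I A s.
  by move=> u urows; apply: As; rewrite inE urows orbT.
have [|K' [B' [v' [vE AB']]]] := flatJ K (fun k => \sum_i A t i * B i k) v.
  suff -> : \sum_k f (\sum_i A t i * B i k) * v k = \sum_i f (A t i) * s i.
    by apply: As; rewrite inE eqxx.
  under eq_bigr do rewrite rmorph_sum mulr_suml.
  rewrite exchange_big; apply: eq_bigr => i _ /=; rewrite sE mulr_sumr.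
  by apply: eq_bigr => k _; rewrite rmorphM mulrA.
exists K', (fun i k' => \sum_k B i k * B' k k'), v'; split=> [i|u k'].
  rewrite sE; under [RHS]eq_bigr do rewrite rmorph_sum mulr_suml.
  rewrite exchange_big; apply: eq_bigr => k _ /=; rewrite vE mulr_sumr.
  by apply: eq_bigr => k' _; rewrite rmorphM mulrA.
have -> : \sum_i A u i * (\sum_k B i k * B' k k') =
    \sum_k (\sum_i A u i * B i k) * B' k k'.
  under eq_bigr do rewrite mulr_sumr.
  rewrite exchange_big; apply: eq_bigr => k _ /=; rewrite mulr_suml.
  by apply: eq_bigr => i _; rewrite mulrA.
rewrite inE => /orP[/eqP -> //|urows]; apply: (subgroup_sum idJ) => k _.
by rewrite mulrC; apply: (idealM idJ); exact: AB.
Qed.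

(** The error term sum t_l f(b_l), with b_l in J2, is moved into the relation as extra unknowns -t_l
    with coefficients b_l; the enlarged relation holds exactly. *)
Lemma flat_mod_mono (J1 J2 : R -> Prop) : is_ideal J1 -> is_ideal J2 ->
  (forall x, J1 x -> J2 x) -> flat_mod J1 -> flat_mod J2.
Proof.
move=> id1 id2 J12 flat1 I a s /ideal_span_sum [n [g [t [gP asE]]]].
have [b bP] : exists b : 'I_n -> R, forall l, J2 (b l) /\ g l = f (b l).
  apply: (choice_fun (Q := fun l b => J2 b /\ g l = f b)) => l.
  by have [b Jb ->] := gP l; exists b.
have [|K [B [v [sE AB]]]] := flat1 (I + 'I_n)%type
   (fun u => match u with inl i => a i | inr l => b l end)
   (fun u => match u with inl i => s i | inr l => - t l end).
  rewrite big_sumType /= asE -big_split big1; first exact: IdealSpan0.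
  by move=> l _ /=; rewrite (bP l).2 mulrN [t l * _]mulrC subrr.
exists K, (fun i k => B (inl i) k), v; split=> [i|k]; first exact: (sE (inl i)).
have := J12 _ (AB k); rewrite big_sumType /= => Jk.
have -> : \sum_i a i * B (inl i) k = \sum_i a i * B (inl i) k +
    \sum_l b l * B (inr l) k - \sum_l b l * B (inr l) k by rewrite addrK.
apply: (subB id2) => //; apply: (subgroup_sum id2) => l _.
by rewrite mulrC; apply: (idealM id2); exact: (bP l).1.
Qed.
End Flatness.

(** * Flatness from bijectivity of the relative Frobenius *)

Section FrobeniusFlatness.
Context (p : nat) (R S : comPzRingType) (f : {rmorphism R -> S}).
Context (p_prime : prime p) (charR : (p%:R : R) = 0) (charS : (p%:R : S) = 0).
Context (N : nat) (r : 'I_N -> R).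
Hypothesis r_gen : forall y, exists c : 'I_N -> R, y = \sum_i c i ^+ p * r i.
Hypothesis frob_surj :
  forall s, exists y : 'I_N -> S, s = \sum_h f (r h) * y h ^+ p.
Hypothesis frob_rels : forall y : 'cV[S]_N, \sum_h f (r h) * y h 0 ^+ p = 0 ->
  exists k (A : 'M[R]_(N, k)) (z : 'cV[S]_k),
    y = map_mx f A *m z /\ forall g, \sum_h A h g ^+ p * r h = 0.

Definition frob_ideal (J : R -> Prop) : R -> Prop :=
  ideal_span (fun x => exists2 b, J b & x = b ^+ p).

Lemma frob_ideal_pow J x : is_ideal J -> J x -> frob_ideal J (x ^+ p).
Proof. by move=> idJ Jx; apply: ideal_span_gen; exists x. Qed.

Lemma ext_frob_ideal J x : ext_ideal f (frob_ideal J) x ->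
  exists n (b : 'I_n -> R) (t : 'I_n -> S),
    (forall l, J (b l)) /\ x = \sum_l f (b l) ^+ p * t l.
Proof.
move=> Jx; have /ideal_span_sum [n [g [t [gP ->]]]] :
    ideal_span (fun x => exists2 b, J b & x = f b ^+ p) x.
  apply: ideal_span_min Jx => [|_ [b Jb ->]]; first exact: ideal_span_ideal.
  elim: Jb => [|a _ y [c Jc ->] _ IH]; first by rewrite rmorph0; exact: IdealSpan0.
  rewrite rmorphD rmorphM rmorphXn; apply: IdealSpanD => //.
  by exists c.
have [b bP] : exists b : 'I_n -> R, forall l, J (b l) /\ g l = f (b l) ^+ p.
  apply: (choice_fun (Q := fun l b => J b /\ g l = f b ^+ p)) => l.
  by have [b Jb ->] := gP l; exists b.
exists n, b, t; split=> [l|]; first exact: (bP l).1.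
by apply: eq_bigr => l _; rewrite (bP l).2 mulrC.
Qed.

(* Frobenius maps R / J to R / J^[p], and S / J^[p]S is the base change of    *)
(* S / JS along it because relative Frobenius is an isomorphism.              *)
Lemma flat_mod_frob J : is_ideal J -> flat_mod f J -> flat_mod f (frob_ideal J).
Proof.
move=> idJ flatJ I a s /ext_frob_ideal [n [b [t [Jb asE]]]].
have [co coE] := choice_fun r_gen.
have [Y YE] := choice_fun (fun i => frob_surj (s i)).
have [W WE] := choice_fun (fun l => frob_surj (t l)).
(* Expanding s, t and the products a_i r_h in the generators r turns the relation modulo the
   Frobenius power of J into sum_h' f(r_h') y_h'^p = 0. *)
pose y : 'cV[S]_N := \col_h' (\sum_u f (co (a u.1 * r u.2) h') * Y u.1 u.2
  - \sum_l f (b l) * W l h').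
have [|k [D [z [yE Dr]]]] := frob_rels (y := y).
  under eq_bigr do rewrite mxE (frobenius_sub p_prime charS)
    !(frobenius_sum p_prime charS) mulrBr.
  rewrite sumrB; apply/eqP; rewrite subr_eq0; apply/eqP.
  transitivity (\sum_i f (a i) * s i).
    under eq_bigr do rewrite mulr_sumr.
    rewrite exchange_big /= -(pair_bigA _ (fun i h => \sum_h' f (r h') *
      (f (co (a i * r h) h') * Y i h) ^+ p)) /=.
    apply: eq_bigr => i _; rewrite [in RHS]YE mulr_sumr.
    apply: eq_bigr => h _; rewrite mulrA -rmorphM {2}(coE (a i * r h)).
    rewrite rmorph_sum mulr_suml; apply: eq_bigr => h' _.
    by rewrite exprMn rmorphM rmorphXn; ring.
  rewrite asE; under eq_bigr do rewrite WE mulr_sumr.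
  rewrite exchange_big /=; apply: eq_bigr => h' _.
  rewrite mulr_sumr; apply: eq_bigr => l _.
  by rewrite exprMn; ring.
(* By [frob_rels], taking p-th roots leaves one relation modulo J for each h', in the unknowns Y and
   the auxiliary z. *)
pose A h' (u : (I * 'I_N) + 'I_k) :=
  match u with inl v => co (a v.1 * r v.2) h' | inr g => - D h' g end.
pose sv (u : (I * 'I_N) + 'I_k) :=
  match u with inl v => Y v.1 v.2 | inr g => z g 0 end.
have [|K [B [v [svE AB]]]] := flat_mod_system idJ flatJ
    (rows := index_enum 'I_N) (A := A) (s := sv).
  move=> h' _; rewrite big_sumType /=.
  have yh : \sum_u f (co (a u.1 * r u.2) h') * Y u.1 u.2 =
      \sum_l f (b l) * W l h' + \sum_g f (D h' g) * z g 0.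
    have := congr1 (fun M : 'cV_N => M h' 0) yE; rewrite !mxE => /eqP.
    rewrite subr_eq addrC => /eqP ->; congr (_ + _).
    by apply: eq_bigr => g _; rewrite mxE.
  rewrite yh -addrA -big_split /= [X in _ + X]big1 ?addr0.
    apply: (subgroup_sum (ideal_span_ideal _)) => l _; rewrite mulrC.
    by apply: ideal_span_mul; apply: ideal_span_gen; exists (b l).
  by move=> g _; rewrite rmorphN mulNr subrr.
(* Frobenius is applied to the trivialisation modulo J; the columns of [D] drop out because they are
   relations among the r_h. *)
exists K, (fun i kk => \sum_h r h * B (inl (i, h)) kk ^+ p), (fun kk => v kk ^+ p).
split=> [i|kk].
  rewrite YE; under [RHS]eq_bigr do rewrite rmorph_sum mulr_suml.
  rewrite exchange_big; apply: eq_bigr => h _ /=.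
  rewrite [Y i h](svE (inl (i, h))) (frobenius_sum p_prime charS) mulr_sumr.
  by apply: eq_bigr => kk _; rewrite exprMn rmorphM rmorphXn mulrA.
have -> : \sum_i a i * (\sum_h r h * B (inl (i, h)) kk ^+ p) =
    \sum_h' r h' * (\sum_u A h' u * B u kk) ^+ p.
  transitivity (\sum_h' r h' * (\sum_u A h' (inl u) * B (inl u) kk) ^+ p).
    transitivity (\sum_(u : I * 'I_N) (a u.1 * r u.2) * B (inl u) kk ^+ p).
      transitivity (\sum_i \sum_h a i * r h * B (inl (i, h)) kk ^+ p); last first.
        by rewrite pair_bigA; apply: eq_bigr => -[].
      apply: eq_bigr => i _; rewrite mulr_sumr; apply: eq_bigr => h _.
      by rewrite mulrA.
    under [RHS]eq_bigr do rewrite (frobenius_sum p_prime charR) mulr_sumr.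
    rewrite [RHS]exchange_big; apply: eq_bigr => u _ /=.
    rewrite {1}(coE (a u.1 * r u.2)) mulr_suml; apply: eq_bigr => h' _.
    by rewrite exprMn; ring.
  have Dr0 : \sum_h' r h' * (\sum_g A h' (inr g) * B (inr g) kk) ^+ p = 0.
    under eq_bigr do rewrite (frobenius_sum p_prime charR) mulr_sumr.
    rewrite exchange_big big1 // => g _ /=.
    transitivity (- B (inr g) kk ^+ p * \sum_h D h g ^+ p * r h).
      rewrite mulr_sumr; apply: eq_bigr => h _.
      by rewrite exprMn (frobenius_opp p_prime charR); ring.
    by rewrite Dr mulr0.
  rewrite -[LHS]addr0 -[X in _ + X = _]Dr0 -big_split; apply: eq_bigr => h' _ /=.
  by rewrite big_sumType (frobenius_add p_prime charR) mulrDr.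
apply: (subgroup_sum (ideal_span_ideal _)) => h' _; apply: ideal_span_mul.
by apply: frob_ideal_pow => //; apply: AB; exact: mem_index_enum.
Qed.

Hypotheses (noethR : noetherian_ring R) (noethS : noetherian_ring S).

Definition power_ideal m (g : 'I_m -> R) (k : nat) (x : R) : Prop :=
  exists c : 'I_m -> R, x = \sum_i c i * g i ^+ k.

Lemma power_ideal_ideal m (g : 'I_m -> R) k : is_ideal (power_ideal g k).
Proof.
split=> [|a _ [c ->]]; last first.
  exists (fun i => a * c i); rewrite mulr_sumr; apply: eq_bigr => i _.
  by rewrite mulrA.
split=> [|_ _ [c ->] [d ->]].
  by exists (fun=> 0); rewrite big1 // => i _; rewrite mul0r.
exists (fun i => c i - d i); rewrite -sumrB; apply: eq_bigr => i _.
by rewrite mulrBl.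
Qed.

(** The Frobenius power of the ideal of q-th powers of the g_i lies in the ideal of their pq-th
    powers, so [flat_mod_frob] can be iterated. *)
Lemma flat_mod_power (P : R -> Prop) m (g : 'I_m -> R) e : is_ideal P ->
  flat_mod f P -> (forall x, P x -> power_ideal g 1 x) ->
  flat_mod f (power_ideal g (p ^ e)).
Proof.
move=> idP flatP Pg; elim: e => [|e IH].
  exact: flat_mod_mono (power_ideal_ideal g 1) Pg flatP.
apply: flat_mod_mono (ideal_span_ideal _) (power_ideal_ideal g _) _
  (flat_mod_frob (power_ideal_ideal g _) IH).
apply: ideal_span_min (power_ideal_ideal g _) _ => _ [_ [c ->] ->].
exists (fun i => c i ^+ p); rewrite (frobenius_sum p_prime charR).
by apply: eq_bigr => i _; rewrite exprMn -exprM expnSr.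
Qed.

Section Step.
Context (J : R -> Prop) (idJ : is_ideal J).
Hypothesis IH : forall J', is_ideal J' -> (forall x, J x -> J' x) ->
  ~ (forall x, J' x -> J x) -> flat_mod f J'.
Context (n : nat) (a : 'I_n -> R) (s : 'I_n -> S).
Hypothesis Jas : ext_ideal f J (\sum_i f (a i) * s i).

Definition trivial_relation (y : 'cV[S]_n) : Prop :=
  exists (K : finType) (B : 'I_n -> K -> R) (v : K -> S),
    (forall i, y i 0 = \sum_k f (B i k) * v k) /\
    (forall k, J (\sum_i a i * B i k)).

Let W := trivial_relation.

Lemma trivial_relation_submodule : is_submodule W.
Proof.
split=> [|c y [K [B [v [yE aB]]]]]; last first.
  exists K, B, (fun k => c * v k); split=> // i.
  by rewrite mxE yE mulr_sumr; apply: eq_bigr => k _; rewrite mulrCA.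
split=> [|y y' [K [B [v [yE aB]]]] [K' [B' [v' [yE' aB']]]]].
  exists 'I_0, (fun _ _ => 0), (fun=> 0); split=> [i|[]//].
  by rewrite mxE big_ord0.
exists (K + K')%type,
  (fun i u => match u with inl k => B i k | inr k => B' i k end),
  (fun u => match u with inl k => v k | inr k => - v' k end); split=> [i|[k|k]] //.
rewrite !mxE yE yE' big_sumType /= -sumrN; congr (_ + _).
by apply: eq_bigr => k _; rewrite mulrN.
Qed.

Let subW := trivial_relation_submodule.
Let sv : 'cV[S]_n := \col_i s i.
Let P (c : R) := W (f c *: sv).

Lemma annihilator_ideal : is_ideal P.
Proof.
split=> [|c x Wx]; last by rewrite /P rmorphM -scalerA; exact: (submodZ subW).
split=> [|x y Wx Wy]; first by rewrite /P rmorph0 scale0r; exact: (sub0 subW).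
by rewrite /P rmorphB scalerBl; exact: (subB subW).
Qed.

Lemma base_sub_annihilator c : J c -> P c.
Proof.
move=> Jc; exists 'I_n, (fun i k => c * (i == k)%:R), s; split=> [i|k].
  rewrite !mxE (bigD1 i) //= eqxx mulr1 big1 ?addr0 // => k /negPf ki.
  by rewrite eq_sym ki mulr0 rmorph0 mul0r.
by apply: (subgroup_sum idJ) => i _; rewrite mulrCA; rewrite mulrC; exact: (idealM idJ).
Qed.

(* By the Koszul relations. *)
Lemma coef_annihilator i0 : P (a i0).
Proof.
rewrite /P; pose as_ := \sum_i f (a i) * s i.
have -> : f (a i0) *: sv = \col_i (f (a i0) * s i - (i == i0)%:R * as_) +
    \col_i ((i == i0)%:R * as_).
  by apply/colP => i; rewrite !mxE subrK.
apply: (subgroupD subW); last first.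
  rewrite /as_; elim: Jas => [|c _ y [b Jb ->] _ IHy].
    suff -> : \col_i ((i == i0)%:R * 0) = 0 :> 'cV[S]_n by exact: (sub0 subW).
    by apply/colP => i; rewrite !mxE mulr0.
  have -> : \col_i ((i == i0)%:R * (y + c * f b)) =
      \col_i ((i == i0)%:R * y) + \col_i ((i == i0)%:R * (c * f b)) :> 'cV[S]_n.
    by apply/colP => i; rewrite !mxE mulrDr.
  apply: (subgroupD subW) => //.
  exists unit, (fun i _ => (i == i0)%:R * b), (fun=> c); split=> [i|_].
    by rewrite mxE big_const card_unit /= addr0 rmorphM rmorph_nat; ring.
  apply: (subgroup_sum idJ) => i _; rewrite mulrA; exact: (idealM idJ).
exists 'I_n, (fun i l => (i == l)%:R * a i0 - (i == i0)%:R * a l), s.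
split=> [i|l].
  rewrite mxE; under eq_bigr do rewrite rmorphB !rmorphM !rmorph_nat mulrBl.
  rewrite sumrB; congr (_ - _).
    rewrite (bigD1 i) //= eqxx mul1r big1 ?addr0 // => l /negPf li.
    by rewrite eq_sym li !mul0r.
  by rewrite mulr_sumr; apply: eq_bigr => l _; rewrite mulrA.
under eq_bigr do rewrite mulrBr.
rewrite sumrB (bigD1 l) //= eqxx mul1r big1 ?addr0; last first.
  by move=> i /negPf il; rewrite il mul0r mulr0.
rewrite (bigD1 i0) //= eqxx mul1r big1 ?addr0; last first.
  by move=> i /negPf il; rewrite il mul0r mulr0.
by rewrite mulrC subrr; exact: (sub0 idJ).
Qed.

(** Let the g_i generate P, and write (g^q) for the ideal of their q-th powers. Since P sends s into
    W, by Artin-Rees in S^n it suffices that s lies in W + (g^q) S^n for one large q. Flatness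
    modulo J + (g^q') writes s = B v with aB in J + (g^q'). For q' large, Artin-Rees in R gives aB =
    ac modulo J with c in (g^q). Then (B - c) v is trivial and c v lies in (g^q) S^n. *)
Lemma flat_mod_step : W sv.
Proof.
(* If P = J, the coefficients lie in J and the identity matrix trivialises s. *)
have [PJ|nPJ] := classic (forall x, P x -> J x).
  exists 'I_n, (fun i k => (i == k)%:R), s; split=> [i|k].
    rewrite !mxE (bigD1 i) //= eqxx rmorph1 mul1r big1 ?addr0 // => k /negPf ki.
    by rewrite eq_sym ki rmorph0 mul0r.
  rewrite (bigD1 k) //= eqxx mulr1 big1 ?addr0; first exact/PJ/coef_annihilator.
  by move=> i /negPf ->; rewrite mulr0.
have flatP := IH annihilator_ideal base_sub_annihilator nPJ.
have [m [g gP]] := fg_ideal noethR annihilator_ideal.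
pose gi i := g 0 i.
have Pgi i : P (gi i).
  apply/gP; exists (delta_mx i 0); rewrite mxE (bigD1 i) //= mxE !eqxx mulr1.
  by rewrite big1 ?addr0 // => j /negPf ji; rewrite mxE ji mulr0.
have flatpow e : flat_mod f (power_ideal gi (p ^ e)).
  apply: flat_mod_power annihilator_ideal flatP _ => x /gP [c ->].
  by exists (fun i => c i 0); rewrite mxE; apply: eq_bigr => i _; rewrite mulrC.
(* Each f(g_i) sends [NS] into W, so Artin-Rees provides [L'] meeting [NS] only in W and absorbing
   high powers of the f(g_i). *)
pose NS (y : 'cV[S]_n) := exists c w, W w /\ y = c *: sv + w.
have [|L' [subL' WL' L'N [K0 K0P]]] :=
    artin_rees noethS (gs := [seq f (gi i) | i <- enum 'I_m]) (N := NS) subW.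
  move=> _ /mapP [i _ ->]; exists 1%N => _ [c [w [Ww ->]]].
  rewrite expr1 scalerDr scalerA mulrC -scalerA; apply: (subgroupD subW).
    by apply: (submodZ subW); exact: Pgi.
  exact: (submodZ subW).
pose q := (p ^ K0)%N.
have K0q : (K0 <= q)%N by apply/ltnW/ltn_expl/prime_gt1.
(* [I2] is J + a (g^q) and [NR] below is J + (a); each g_i^q multiplies [NR] into [I2]. *)
pose I2 x := exists c : 'I_n -> R,
  (forall i, power_ideal gi q (c i)) /\ J (x - \sum_i a i * c i).
have idI2 : is_ideal I2.
  split=> [|b x [c [cq Jx]]]; last first.
    exists (fun i => b * c i); split=> [i|].
      exact: (idealM (power_ideal_ideal gi q)).
    suff -> : b * x - \sum_i a i * (b * c i) = b * (x - \sum_i a i * c i).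
      exact: (idealM idJ).
    rewrite mulrBr mulr_sumr; congr (_ - _); apply: eq_bigr => i _.
    by rewrite mulrCA.
  split=> [|x y [c [cq Jx]] [d [dq Jy]]].
    exists (fun=> 0); split=> [i|]; first exact: (sub0 (power_ideal_ideal gi q)).
    rewrite big1 ?subrr; first exact: (sub0 idJ).
    by move=> i _; rewrite mulr0.
  exists (fun i => c i - d i); split=> [i|].
    exact: (subB (power_ideal_ideal gi q)).
  suff -> : x - y - \sum_i a i * (c i - d i) =
      (x - \sum_i a i * c i) - (y - \sum_i a i * d i) by exact: (subB idJ).
  under eq_bigr do rewrite mulrBr.
  by rewrite sumrB; ring.
pose NR (x : 'cV[R]_1) := exists c : 'I_n -> R, J (x 0 0 - \sum_i a i * c i).
have subI2 : is_submodule (fun x : 'cV[R]_1 => I2 (x 0 0)).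
  split=> [|b x Ix]; last by rewrite mxE; exact: (idealM idI2).
  split=> [|x y Ix Iy]; first by rewrite mxE; exact: (sub0 idI2).
  by rewrite !mxE; exact: (subB idI2).
have [|L2 [subL2 IL2 L2N [K1 K1P]]] :=
    artin_rees noethR (gs := [seq gi i | i <- enum 'I_m]) (N := NR) subI2.
  move=> _ /mapP [i _ ->]; exists q => y [c Jy].
  exists (fun l => gi i ^+ q * c l); split=> [l|].
    exists (fun i' => (i == i')%:R * c l); rewrite (bigD1 i) //= eqxx mul1r.
    rewrite mulrC big1 ?addr0 // => i' /negPf i'i.
    by rewrite eq_sym i'i !mul0r.
  suff -> : (gi i ^+ q *: y) 0 0 - \sum_i0 a i0 * (gi i ^+ q * c i0) =
      gi i ^+ q * (y 0 0 - \sum_i a i * c i) by exact: (idealM idJ).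
  rewrite mxE mulrBr mulr_sumr; congr (_ - _); apply: eq_bigr => l _.
  by rewrite mulrCA.
pose q' := (p ^ K1)%N.
have K1q : (K1 <= q')%N by apply/ltnW/ltn_expl/prime_gt1.
pose J3 x := exists y z, [/\ J y, power_ideal gi q' z & x = y + z].
have idJ3 : is_ideal J3.
  split=> [|b _ [y [z [Jy Pz ->]]]]; last first.
    exists (b * y), (b * z); rewrite mulrDr.
    by split=> //; [exact: (idealM idJ)|exact: (idealM (power_ideal_ideal gi q'))].
  split=> [|_ _ [y [z [Jy Pz ->]]] [y' [z' [Jy' Pz' ->]]]].
    exists 0, 0; rewrite addr0.
    by split=> //; [exact: (sub0 idJ)|exact: (sub0 (power_ideal_ideal gi q'))].
  exists (y - y'), (z - z'); rewrite opprD addrACA.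
  by split=> //; [exact: (subB idJ)|exact: (subB (power_ideal_ideal gi q'))].
have flat3 : flat_mod f J3.
  apply: flat_mod_mono (power_ideal_ideal gi q') idJ3 _ (flatpow K1) => x Px.
  by exists 0, x; split; [exact: (sub0 idJ)| |rewrite add0r].
have [|K [B [v [sE aB]]]] := flat3 'I_n a s.
  apply: ideal_span_min Jas => [|_ [b Jb ->]]; first exact: ideal_span_ideal.
  apply: ideal_span_gen; exists b => //; exists b, 0; rewrite addr0; split=> //.
  exact: (sub0 (power_ideal_ideal gi q')).
have [c cP] : exists c : K -> 'I_n -> R, forall k,
    (forall i, power_ideal gi q (c k i)) /\
    J (\sum_i a i * B i k - \sum_i a i * c k i).
  apply: (choice_fun (Q := fun k (c : 'I_n -> R) =>
    (forall i, power_ideal gi q (c i)) /\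
    J (\sum_i a i * B i k - \sum_i a i * c i))) => k.
  have := L2N ((\sum_i a i * B i k)%:M).
  rewrite mxE eqxx mulr1n; apply.
    exists (B^~ k); rewrite mxE eqxx mulr1n subrr; exact: (sub0 idJ).
  have [y [_ [Jy [d ->] ->]]] := aB k.
  rewrite raddfD raddf_sum /=; apply: (subgroupD subL2).
    apply: IL2; rewrite mxE eqxx mulr1n; exists (fun=> 0); split=> [i|].
      exact: (sub0 (power_ideal_ideal gi q)).
    by rewrite big1 ?subr0 // => i _; rewrite mulr0.
  apply: (subgroup_sum subL2) => i _; rewrite mulrC -scale_scalar_mx.
  by apply: K1P => //; rewrite map_f // mem_enum.
have [d dP] : exists d : K * 'I_n -> 'I_m -> R, forall u,
    c u.1 u.2 = \sum_l d u l * gi l ^+ q.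
  apply: (choice_fun (Q := fun u (d : 'I_m -> R) =>
    c u.1 u.2 = \sum_l d l * gi l ^+ q)) => -[k i].
  exact: (cP k).1.
apply: L'N.
  by exists 1, 0; rewrite scale1r addr0; split=> //; exact: (sub0 subW).
have -> : sv = \col_i (\sum_k f (B i k - c k i) * v k) +
    \sum_l f (gi l) ^+ q *: \col_i \sum_k f (d (k, i) l) * v k.
  apply/colP => i; rewrite !mxE summxE sE.
  under [X in _ = _ + X]eq_bigr do rewrite !mxE mulr_sumr.
  rewrite exchange_big -big_split; apply: eq_bigr => k _ /=.
  rewrite rmorphB mulrBl -[LHS](subrK (f (c k i) * v k)); congr (_ + _).
  have cE : c k i = \sum_l d (k, i) l * gi l ^+ q := dP (k, i).
  rewrite cE rmorph_sum mulr_suml; apply: eq_bigr => l _.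
  by rewrite rmorphM rmorphXn; ring.
apply: (subgroupD subL'); last first.
  apply: (subgroup_sum subL') => l _; apply: K0P => //.
  by apply: (map_f (fun i => f (gi i))); rewrite mem_enum.
apply: WL'; exists K, (fun i k => B i k - c k i), v; split=> [i|k].
  by rewrite mxE.
under eq_bigr do rewrite mulrBr.
by rewrite sumrB; exact: (cP k).2.
Qed.
End Step.

Theorem relatively_perfect_flat : flat_mod f (fun x => x = 0).
Proof.
apply: (noetherian_ind noethR) => [J idJ IH|]; last first.
  split=> [|b _ ->]; last by rewrite mulr0.
  by split=> // _ _ -> ->; rewrite subrr.
move=> I a s Jas.
have reindexI (V : zmodType) (F : I -> V) :
    \sum_(i < #|I|) F (enum_val i) = \sum_i F i.
  rewrite [RHS](reindex_onto enum_val enum_rank) /= => [|i _].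
    by apply: eq_bigl => i; rewrite enum_valK eqxx.
  exact: enum_rankK.
have [|K [B [v [sE aB]]]] := flat_mod_step idJ IH
    (a := fun i : 'I_#|I| => a (enum_val i)) (s := fun i => s (enum_val i)).
  by rewrite (reindexI _ (fun i => f (a i) * s i)).
exists K, (fun i k => B (enum_rank i) k), v; split=> [i|k].
  by have := sE (enum_rank i); rewrite mxE enum_rankK.
have := aB k; rewrite -(reindexI _ (fun i => a i * B (enum_rank i) k)).
by under [X in _ -> J X]eq_bigr do rewrite enum_valK.
Qed.
End FrobeniusFlatness.

(** * Exactness of the standard resolution *)

Section AugmentedSimplicialGroup.
Context (X : nat -> zmodType) (d : forall n, nat -> {additive X n.+1 -> X n}).
Context (s : forall n, nat -> {additive X n.+1 -> X n.+2}).
Context (h : forall n, X n -> X n.+1).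
Hypothesis dd : forall n i j x, (i <= j <= n)%N ->
  d n i (d n.+1 j.+1 x) = d n j (d n.+1 i x).
Hypothesis ds_lt : forall n i j x, (i <= j <= n)%N ->
  d n.+2 i (s n.+1 j.+1 x) = s n j (d n.+1 i x).
Hypothesis ds_id : forall n j x, (j <= n)%N -> d n.+1 j (s n j x) = x.
Hypothesis dSs_id : forall n j x, (j <= n)%N -> d n.+1 j.+1 (s n j x) = x.
Hypothesis ds_gt : forall n i j x, (j <= i <= n)%N ->
  d n.+2 i.+2 (s n.+1 j x) = s n j (d n.+1 i.+1 x).
Hypothesis dh0 : forall n (x : X n), d n 0 (h x) = x.
Hypothesis dhS : forall n i x, d n.+1 i.+1 (h x) = h (d n i x).

Definition alt_face n (x : X n.+1) : X n := \sum_(i < n.+1) d n i x *~ (-1) ^+ i.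

Lemma alt_face_zmod_morphism n : zmod_morphism (@alt_face n).
Proof.
move=> x y; rewrite /alt_face -sumrB; apply: eq_bigr => i _.
by rewrite raddfB mulrzBl.
Qed.

HB.instance Definition _ n := GRing.isZmodMorphism.Build (X n.+1) (X n)
  (@alt_face n) (@alt_face_zmod_morphism n).

Lemma alt_face2 n (x : X n.+2) : alt_face (alt_face x) = 0.
Proof.
pose G i j := d n i (d n.+1 j x) *~ (-1) ^+ (i + j).
transitivity (\sum_(i < n.+1) \sum_(j < n.+2) G i j).
  apply: eq_bigr => i _; rewrite raddf_sum mulrz_suml; apply: eq_bigr => j _.
  by rewrite /G raddfMz -mulrzA exprD mulrC.
transitivity (\sum_(i < n.+1) \sum_(j < n.+1) (if (j <= i)%N then G i j else 0)
    + \sum_(i < n.+1) \sum_(j < n.+1) (if (i <= j)%N then - G j i else 0)).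
  rewrite -big_split; apply: eq_bigr => i _ /=.
  rewrite (bigID (fun j : 'I_n.+2 => (j <= i)%N)) /=; congr (_ + _).
    by rewrite big_mkcond big_ord_recr /= ifF ?addr0 // leqNgt ltn_ord.
  rewrite big_mkcond big_ord_recl /= add0r; apply: eq_bigr => j _.
  rewrite /bump add1n -ltnNge ltnS; case: leqP => // ij.
  rewrite /G dd; last by rewrite ij -ltnS ltn_ord.
  by rewrite addnS exprS mulN1r mulrNz addnC.
rewrite [X in _ + X]exchange_big /= -big_split big1 // => i _.
rewrite -big_split big1 // => j _ /=.
by case: ifP => _; rewrite ?addr0 ?subrr.
Qed.

(** The extra degeneracy [h] is not assumed additive, whence the correction by [h 0]: the zeroth
    face of [h x - h 0] is x, and the others are differences of equal terms. *)
Lemma normalized_exact n (x : X n.+1) : (forall i, (i <= n)%N -> d n i x = 0) ->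
  exists y, x = alt_face y.
Proof.
move=> dx; exists (h x - h 0); rewrite /alt_face big_ord_recl expr0 mulr1z.
rewrite raddfB !dh0 subr0 big1 ?addr0 // => i _.
rewrite raddfB !dhS dx ?raddf0 ?subrr ?mul0rz //.
by rewrite -ltnS ltn_ord.
Qed.

(* Modifying a cycle by boundaries of degenerate elements kills its faces one *)
(* after the other, starting with the last one.                               *)
Lemma alt_face_exact n (x : X n.+1) : alt_face x = 0 -> exists y, x = alt_face y.
Proof.
suff H k : (k <= n)%N -> forall z : X n.+1, alt_face z = 0 ->
    (forall i, (k < i <= n)%N -> d n i z = 0) -> exists y, z = alt_face y.
  by move=> x0; apply: (H n) => // i /andP[ni]; rewrite leqNgt ni.
elim: k {x} => [_ z z0 dz|k IH kn z z0 dz].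
  apply: normalized_exact => -[_|i ni]; last exact: dz.
  move: z0; rewrite /alt_face big_ord_recl expr0 mulr1z big1 ?addr0 // => i _.
  by rewrite dz ?mul0rz //= /bump add1n ltn_ord.
move: z0 dz kn IH; case: n z => [|n] z // z0 dz kn IH.
(* Among the faces of s_(k+1) z, those of index above k+2 vanish, those of index k+1 and k+2 cancel,
   and the lower ones add up to s_k of the lower part of the boundary of z, which is minus its term
   of index k+1. *)
have sk : alt_face (s n.+1 k.+1 z) = - (s n k (d n.+1 k.+1 z) *~ (-1) ^+ k.+1).
  have split_z : \sum_(0 <= i < k.+1) d n.+1 i z *~ (-1) ^+ i =
      - (d n.+1 k.+1 z *~ (-1) ^+ k.+1).
    have tail : \sum_(k.+2 <= i < n.+2) d n.+1 i z *~ (-1) ^+ i = 0.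
      rewrite big_nat big1 // => i /andP[ki ni].
      by rewrite dz ?mul0rz // ki -ltnS.
    apply/eqP; rewrite -addr_eq0; apply/eqP; rewrite -[RHS]z0 /alt_face.
    rewrite -(big_mkord xpredT (fun i => d n.+1 i z *~ (-1) ^+ i)).
    rewrite [RHS](@big_cat_nat _ _ _ k.+1) //=; last exact: leqW.
    by rewrite (@big_ltn _ _ _ k.+1) //= tail addr0.
  rewrite /alt_face.
  rewrite -(big_mkord xpredT (fun i => d n.+2 i (s n.+1 k.+1 z) *~ (-1) ^+ i)).
  rewrite (@big_cat_nat _ _ _ k.+1) //=; last by rewrite ltnS ltnW // ltnW.
  rewrite (@big_ltn _ _ _ k.+1) //; last by rewrite ltnS ltnW.
  rewrite (@big_ltn _ _ _ k.+2) // ds_id // dSs_id //.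
  have tail : \sum_(k.+3 <= i < n.+3) d n.+2 i (s n.+1 k.+1 z) *~ (-1) ^+ i = 0.
    rewrite big_nat big1 // => -[|[|i]] // /andP[ki ni].
    have {}ki : (k < i)%N by [].
    have {}ni : (i <= n)%N by [].
    by rewrite ds_gt ?ki // dz ?raddf0 ?mul0rz // ltnS ki.
  rewrite tail addr0.
  rewrite (exprS _ k.+1) mulN1r mulrNz subrr addr0.
  rewrite -raddfMz -raddfN -split_z raddf_sum; rewrite !big_nat.
  apply: eq_bigr => i /andP[_ ik]; rewrite raddfMz ds_lt //.
  by rewrite -ltnS ik -ltnS.
pose w : X n.+3 := s n.+1 k.+1 z *~ (-1) ^+ k.+1.
have wE : alt_face w = - s n k (d n.+1 k.+1 z).
  rewrite /w raddfMz /= sk mulNrz -mulrzA -exprD addnn -mul2n exprM.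
  by rewrite sqrrN !expr1n mulr1z.
have [||i /andP[ki ni]|y yE] := IH _ (z + alt_face w).
- exact: ltnW.
- by rewrite raddfD /= z0 alt_face2 addr0.
- rewrite raddfD wE raddfN /=; move: ki; rewrite leq_eqVlt => /orP[/eqP <-|ki].
    by rewrite dSs_id // subrr.
  case: i ki ni => [|[|i]] // ki ni; rewrite dz ?ki // add0r.
  case: n z z0 dz kn IH sk w wE ni => // n z z0 dz kn IH sk w wE ni.
  have {}ki : (k <= i)%N by [].
  have {}ni : (i <= n)%N by [].
  rewrite ds_gt; last by rewrite ki.
  rewrite -(@dd n.+1 k.+1 i.+1); last by rewrite ltnS ki.
  by rewrite dz; [rewrite !raddf0 | rewrite !ltnS ki].
by exists (y - w); rewrite raddfB /= -yE addrK.
Qed.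
End AugmentedSimplicialGroup.

(** * Base change along Frobenius *)

Section FlatSubmodules.
Context (R : comPzRingType).

(** The equational criterion for flatness of the R-module W, for finite systems of relations at
    once. *)
Definition flat_sub (M : algOver R) (W : M -> Prop) : Prop :=
  forall (T I : finType) (A : T -> I -> R) (u : I -> M),
  (forall i, W (u i)) -> (forall t, \sum_i alg_in M (A t i) * u i = 0) ->
  exists (K : finType) (B : I -> K -> R) (v : K -> M),
    [/\ forall k, W (v k), forall i, u i = \sum_k alg_in M (B i k) * v k
      & forall t k, \sum_i A t i * B i k = 0].

(** The kernel of a surjection between flat modules is flat: trivialise in M, trivialise the
    resulting relations among the images in W, and correct the vectors by lifts. *)
Lemma flat_kernel (M M' : algOver R) (W : M' -> Prop) (delta : {additive M -> M'}) :
  (forall a x, delta (alg_in M a * x) = alg_in M' a * delta x) ->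
  (forall x, W (delta x)) -> (forall y, W y -> exists x, delta x = y) ->
  flat_sub (fun _ : M => True) -> flat_sub W -> flat_sub (fun x => delta x = 0).
Proof.
move=> deltaZ deltaW delta_surj flatM flatW T I A u u0 Au.
have [//|K [B [v [_ uE AB]]]] := flatM T I A u _ Au.
have [//|i|L [C [w [Ww vE BC]]]] := flatW I K B (fun k => delta (v k)).
  rewrite -[RHS](u0 i) uE raddf_sum; apply: eq_bigr => k _; exact/esym/deltaZ.
have [w' w'E] : exists w' : L -> M, forall l, delta (w' l) = w l.
  by apply: (choice_fun (Q := fun l x => delta x = w l)) => l; exact: delta_surj.
exists K, B, (fun k => v k - \sum_l alg_in M (C k l) * w' l).
split=> [k|i|//].
  rewrite raddfB vE raddf_sum; apply/eqP; rewrite subr_eq0; apply/eqP.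
  by apply: eq_bigr => l _; rewrite deltaZ w'E.
under eq_bigr do rewrite mulrBr mulr_sumr.
rewrite sumrB -uE exchange_big big1 ?subr0 // => l _ /=.
transitivity (alg_in M (\sum_k B i k * C k l) * w' l).
  by rewrite rmorph_sum mulr_suml; apply: eq_bigr => k _; rewrite rmorphM mulrA.
by rewrite BC rmorph0 mul0r.
Qed.

(** Dual basis form: linear coordinates [co] and vectors [e] such that any finite family is
    recovered from finitely many coordinates. *)
Definition has_basis (M : algOver R) : Prop :=
  exists (X : choiceType) (e : X -> M) (co : X -> M -> R),
  [/\ forall x, zmod_morphism (co x),
      forall x a u, co x (alg_in M a * u) = a * co x u
    & forall (I : finType) (u : I -> M), exists (K : finType) (kap : K -> X),
        forall i, u i = \sum_k alg_in M (co (kap k) (u i)) * e (kap k)].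

Lemma flat_basis (M : algOver R) : has_basis M -> flat_sub (fun _ : M => True).
Proof.
move=> [X [e [co [coB coZ co_fin]]]] T I A u _ Au.
have [K [kap uE]] := co_fin I u.
exists K, (fun i k => co (kap k) (u i)), (fun k => e (kap k)); split=> // t k.
pose cok : {additive M -> R} := HB.pack (co (kap k))
  (GRing.isZmodMorphism.Build M R (co (kap k)) (coB (kap k))).
transitivity (cok (\sum_i alg_in M (A t i) * u i)); last by rewrite Au raddf0.
by rewrite raddf_sum; apply: eq_bigr => i _; rewrite /= coZ.
Qed.

Lemma mcoeffUZ (Y : choiceType) (k m : Y) (a c : R) :
  << a * c *g k >>@_m = a * << c *g k >>@_m.
Proof. by rewrite !mcoeffU mulrnAr. Qed.

Lemma polyalg_basis (X : choiceType) : has_basis (polyAlg R X).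
Proof.
exists {cmonom X}, (fun m => << 1 *g m >> : polyAlg R X).
exists (fun m (g : polyAlg R X) => g@_m); split=> [m x y|m a u|I u].
- exact: mcoeffB.
- elim/malg_ind: u => [|u v IHu IHv|c k].
  + by rewrite mulr0 mcoeff0 mulr0.
  + by rewrite mulrDr !mcoeffD mulrDr; congr (_ + _).
  apply: (etrans (congr1 (mcoeff m) (pa_mulE a c mone k))).
  apply: (etrans _ (mcoeffUZ k m a c)).
  exact: (congr1 (fun k' => mcoeff m << a * c *g k' >>) (mul1m k)).
pose D : {fset {cmonom X}} := (\bigcup_(i <- enum I) msupp (u i))%fset.
exists (fset_sub_type D : finType), (@fsval _ D) => i.
have le_D : (msupp (u i) `<=` D)%fset.
  by apply: bigfcup_sup => //; rewrite mem_enum.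
apply: (etrans (monalgEw le_D)); rewrite big_seq_fsetE.
apply: eq_bigr => k _.
apply: (etrans _ (esym (pa_mulE (u i)@_(fsval k) 1 mone (fsval k)))).
exact: (congr2 (fun m' a' => << a' *g m' >> : polyAlg R X)
  (esym (mul1m (fsval k))) (esym (mulr1 _))).
Qed.
End FlatSubmodules.

(** * Acyclicity of the base-changed resolution *)

Section FrobeniusTensor.
Context (p : nat) (R : comPzRingType) (p_prime : prime p).
Hypothesis charR : (p%:R : R) = 0.

Inductive ftensor_gen (T : algOver R) : {malg R[T]} -> Prop :=
| FtensorD (c : R) x y :
    ftensor_gen (<< c *g x + y >> - << c *g x >> - << c *g y >>)
| FtensorZ (c a : R) x :
    ftensor_gen (<< c *g alg_in T a * x >> - << a ^+ p * c *g x >>).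

Definition ftensor_rel (T : algOver R) := subgroup_span (@ftensor_gen T).

Lemma ftensor_lin (T : algOver R) (V : zmodType) (phi : T -> R -> V)
    (phiB : forall x, zmod_morphism (phi x)) :
  (forall c x y, phi (x + y) c = phi x c + phi y c) ->
  (forall c a x, phi (alg_in T a * x) c = phi x (a ^+ p * c)) ->
  forall z, ftensor_rel z -> lin phi z = 0.
Proof.
move=> phiD phiZ z; pose L := lin_additive phiB.
have LU c x : L << c *g x >> = phi x c by exact: (linU phiB).
rewrite -[lin phi z]/(L z); move: z; apply: span_kill => v.
case=> [c x y|c a x]; last by rewrite raddfB !LU phiZ subrr.
by rewrite !raddfB !LU phiD addrAC addrK subrr.
Qed.

(* [q << c *g x >>] is the element [x (x) c] of the base change of [T] along  *)
(* Frobenius.                                                                 *)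
Lemma ftensor_quotient (T : algOver R) (U : {malg R[T]} -> Prop) :
  is_subgroup U -> (forall z, ftensor_rel z -> U z) ->
  exists (V : zmodType) (q : {additive {malg R[T]} -> V}),
  [/\ forall z, q z = 0 <-> U z,
      forall c x y, q << c *g x - y >> = q << c *g x >> - q << c *g y >>,
      forall c (I : Type) (r : seq I) (F : I -> T),
        q << c *g \sum_(i <- r) F i >> = \sum_(i <- r) q << c *g F i >>
    & forall c a x, q << c *g alg_in T a * x >> = q << a ^+ p * c *g x >>].
Proof.
move=> subU relU; have [V [q [_ qP]]] := zmod_quotient subU.
have qE x y : ftensor_rel (x - y) -> q x = q y.
  by move=> /relU/qP; rewrite raddfB => /eqP; rewrite subr_eq0 => /eqP.
have qD c x y : q << c *g x + y >> = q << c *g x >> + q << c *g y >>.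
  by rewrite -raddfD; apply: qE; rewrite opprD addrA; apply: SpanG; exact: FtensorD.
have q0 c : q << c *g 0 >> = 0.
  by apply: (addrI (q << c *g 0 >>)); rewrite -qD !addr0.
exists V, q; split=> // [c x y|c I r F|c a x].
- by apply/eqP; rewrite eq_sym subr_eq -qD subrK.
- elim: r => [|i r IH]; first by rewrite !big_nil q0.
  by rewrite !big_cons qD IH.
- by apply: qE; apply: SpanG; exact: FtensorZ.
Qed.

Section Acyclicity.
Context (X : nat -> algOver R) (d : forall n, nat -> {rmorphism X n.+1 -> X n}).
Hypothesis dC : forall n i a, d n i (alg_in (X n.+1) a) = alg_in (X n) a.

Local Notation bd k x := (@alt_face (fun m => X m) (fun m i => d m i) k x).

Hypothesis bd2 : forall n (x : X n.+2), bd n (bd n.+1 x) = 0.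
Hypothesis bd_surj : forall y, exists x, bd 0 x = y.
Hypothesis bd_exact : forall n (x : X n.+1), bd n x = 0 -> exists y, x = bd n.+1 y.
Hypothesis X_basis : forall n, has_basis (X n.+1).
Hypothesis X0_flat : flat_sub (fun _ : X 0 => True).

Lemma bdZ n a x : bd n (alg_in (X n.+1) a * x) = alg_in (X n) a * bd n x.
Proof.
rewrite /alt_face mulr_sumr; apply: eq_bigr => i _.
rewrite mulrzAr; congr (_ *~ _); rewrite -(dC n i).
exact: (rmorphM (d n i)).
Qed.

Lemma bdB n (x y : X n.+1) : bd n (x - y) = bd n x - bd n y.
Proof. exact: (@alt_face_zmod_morphism (fun m => X m) (fun m i => d m i)). Qed.

Lemma bd_sum n (I : finType) (F : I -> X n.+1) :
  bd n (\sum_i F i) = \sum_i bd n (F i).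
Proof.
pose delta : {additive X n.+1 -> X n} := HB.pack (fun x : X n.+1 => bd n x)
  (GRing.isZmodMorphism.Build (X n.+1) (X n) (fun x => bd n x) (@bdB n)).
exact: (raddf_sum delta).
Qed.

Definition gboundary n (z : {malg R[X n.+2]}) : {malg R[X n.+1]} :=
  \sum_(i < n.+2) push (d n.+1 i) z *~ (-1) ^+ i.

Lemma gboundary_zmod_morphism n : zmod_morphism (@gboundary n).
Proof.
move=> x y; rewrite /gboundary -sumrB; apply: eq_bigr => i _.
by rewrite raddfB mulrzBl.
Qed.

HB.instance Definition _ n := GRing.isZmodMorphism.Build {malg R[X n.+2]}
  {malg R[X n.+1]} (@gboundary n) (@gboundary_zmod_morphism n).

Lemma gboundary_additive n (V : zmodType) (L : {additive {malg R[X n.+1]} -> V}) :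
  (forall c x y, L << c *g x - y >> = L << c *g x >> - L << c *g y >>) ->
  forall c x, L (gboundary << c *g x >>) = L << c *g bd n.+1 x >>.
Proof.
move=> LB c x; pose M : {additive X n.+1 -> V} :=
  HB.pack (fun y => L << c *g y >>)
    (GRing.isZmodMorphism.Build (X n.+1) V (fun y => L << c *g y >>) (LB c)).
rewrite -[RHS]/(M _) /alt_face /gboundary !raddf_sum; apply: eq_bigr => i _.
by rewrite !raddfMz pushU.
Qed.

Lemma gboundary_sum n (I : finType) (F : I -> {malg R[X n.+2]}) :
  gboundary (\sum_i F i) = \sum_i gboundary (F i).
Proof. exact: (raddf_sum (@gboundary n : {additive _ -> _})). Qed.

Definition cycles n : X n -> Prop :=
  match n return X n -> Prop with
  | 0%N => fun=> True
  | m.+1 => fun x => bd m x = 0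
  end.

Lemma cycles_bd n (x : X n.+1) : cycles (bd n x).
Proof. by case: n x => [//|n] x; exact: bd2. Qed.

Lemma cycles_lift n (y : X n) : cycles y -> exists x, bd n x = y.
Proof.
case: n y => [|n] y cy; first exact: bd_surj.
by have [x ->] := bd_exact cy; exists x.
Qed.

Lemma flat_cycles n : flat_sub (@cycles n).
Proof.
elim: n => [|n IH]; first exact: X0_flat.
pose delta : {additive X n.+1 -> X n} := HB.pack (fun x : X n.+1 => bd n x)
  (GRing.isZmodMorphism.Build (X n.+1) (X n) (fun x => bd n x) (@bdB n)).
apply: (@flat_kernel R (X n.+1) (X n) (@cycles n) delta) => //.
- exact: bdZ.
- exact: cycles_bd.
- exact: cycles_lift.
- exact: flat_basis.
Qed.

(** Write z as sum x_i (x) c_i and expand the boundaries of the x_i as sum_k A_ik e_k. Flatness of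
    cycles allows replacing the e_k by boundaries of some w_k. Then x_i - sum_k A_ik w_k is a
    boundary, and what is left of z is sum_k w_k (x) (sum_i A_ik^p c_i) = 0. *)
Lemma ftensor_acyclic n (z : {malg R[X n.+2]}) : ftensor_rel (gboundary z) ->
  exists w, ftensor_rel (z - gboundary w).
Proof.
move=> bz0; pose I : finType := msupp z.
pose x (i : I) : X n.+2 := fsval i; pose c i := z@_(x i).
have zE : z = \sum_i << c i *g x i >> by rewrite {1}[z]monalgE big_seq_fsetE.
have [Y [e [co [coB coZ co_fin]]]] := X_basis n.
have [K [kap bxE]] := co_fin I (fun i => bd n.+1 (x i)).
have coD y u v : co y (u + v) = co y u + co y v.
  by apply/eqP; rewrite -subr_eq -coB addrK.
pose A i k := co (kap k) (bd n.+1 (x i)).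
(* The k-th coordinate of the vanishing boundary: after base change it sends u (x) a to co(u)^p
   a. *)
have Ac k : \sum_i A i k ^+ p * c i = 0.
  pose phi (u : X n.+1) (a : R) := co (kap k) u ^+ p * a.
  have phiB u : zmod_morphism (phi u) by move=> a b; rewrite /phi mulrBr.
  pose L := lin_additive phiB.
  have LU a u : L << a *g u >> = phi u a by exact: (linU phiB).
  have LB a u v : L << a *g u - v >> = L << a *g u >> - L << a *g v >>.
    by rewrite !LU /phi coB (frobenius_sub p_prime charR) mulrBl.
  transitivity (L (gboundary z)); last first.
    apply: (ftensor_lin phiB) bz0 => [a u v|a b u]; rewrite /phi.
      by rewrite coD (frobenius_add p_prime charR) mulrDl.
    by rewrite coZ exprMn; ring.
  rewrite zE gboundary_sum raddf_sum; apply: eq_bigr => i _.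
  by rewrite (gboundary_additive LB) LU.
have [//|i|L [B [v [cv vE AB]]]] := @flat_cycles n I K A (fun k => bd n (e (kap k))).
- by move=> k; exact: cycles_bd.
- rewrite -[RHS](bd2 (x i)) [in RHS]bxE bd_sum; apply: eq_bigr => k _.
  exact/esym/bdZ.
have [v' v'E] := choice_fun (fun l => cycles_lift (cv l)).
(* The correction turns the e_k into cycles, and A B = 0 leaves the combinations with coefficients A
   unchanged. *)
pose e' k := e (kap k) - \sum_l alg_in _ (B k l) * v' l.
have [w wE] : exists w : K -> X n.+2, forall k, e' k = bd n.+1 (w k).
  apply: (choice_fun (Q := fun k w => e' k = bd n.+1 w)) => k.
  apply: bd_exact; rewrite bdB vE bd_sum; apply/eqP.
  rewrite subr_eq0; apply/eqP; apply: eq_bigr => l _.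
  by rewrite bdZ v'E.
have [y yE] : exists y : I -> X n.+3,
    forall i, x i - \sum_k alg_in _ (A i k) * w k = bd n.+2 (y i).
  apply: (choice_fun (Q := fun i y =>
    x i - \sum_k alg_in _ (A i k) * w k = bd n.+2 y)) => i.
  apply: bd_exact; rewrite bdB bd_sum; apply/eqP.
  rewrite subr_eq0; apply/eqP; under [RHS]eq_bigr do rewrite bdZ -wE mulrBr mulr_sumr.
  rewrite sumrB -bxE exchange_big big1 ?subr0 // => l _ /=.
  transitivity (alg_in (X n.+1) (\sum_k A i k * B k l) * v' l).
    by rewrite rmorph_sum mulr_suml; apply: eq_bigr => k _; rewrite rmorphM mulrA.
  by rewrite AB rmorph0 mul0r.
have [V [q [qP qB qS qZ]]] := ftensor_quotient
  (span_subgroup (@ftensor_gen (X n.+2))) (fun z h => h).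
exists (\sum_i << c i *g y i >>); apply/qP.
rewrite {1}zE raddfB gboundary_sum 2!(raddf_sum q) -sumrB.
under eq_bigr do rewrite (gboundary_additive qB) -yE qB opprB addrC subrK qS.
rewrite exchange_big big1 // => k _ /=.
under eq_bigr do rewrite qZ.
transitivity (q << \sum_i A i k ^+ p * c i *g w k >>).
  by rewrite (raddf_sum (mkmalgU (w k))) (raddf_sum q).
by rewrite Ac monalgU0 raddf0.
Qed.
End Acyclicity.
End FrobeniusTensor.

(** * Degeneracies of the standard resolution *)

Section Degeneracies.
Context (R : comPzRingType) (S : algOver R).
Local Notation P n := (tower S n).

(* As for [face], only the values of [j <= n] are used.                       *)
Fixpoint degen (n j : nat) {struct j} : P n.+1 -> P n.+2 :=
  match j with
  | 0%N => @pa_eval R (P n) (P n.+2) (fun x => tvar (tvar x))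
  | j'.+1 =>
      match n return P n.+1 -> P n.+2 with
      | 0%N => @pa_eval R (P 0) (P 2) (fun x => tvar (tvar x))
      | m.+1 => @polyAlg_map R (P m.+1) (P m.+2) (@degen m j')
      end
  end.

Lemma degen_zmod_morphism n j : zmod_morphism (@degen n j).
Proof. by case: j => [|j]; [|case: n => [|n]] => x y; exact: raddfB. Qed.

Lemma degen_monoid_morphism n j : monoid_morphism (@degen n j).
Proof.
case: j => [|j]; [|case: n => [|n]];
  by split=> [|x y]; [exact: rmorph1 | exact: rmorphM].
Qed.

HB.instance Definition _ n j := GRing.isZmodMorphism.Build (P n.+1) (P n.+2)
  (@degen n j) (@degen_zmod_morphism n j).
HB.instance Definition _ n j := GRing.isMonoidMorphism.Build (P n.+1) (P n.+2)
  (@degen n j) (@degen_monoid_morphism n j).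

Lemma degen_const n j c : @degen n j (alg_in (P n.+1) c) = alg_in (P n.+2) c.
Proof.
case: j => [|j]; first exact: (@pa_eval_const R (P n) (P n.+2)).
case: n => [|n]; first exact: (@pa_eval_const R (P 0) (P 2)).
exact: polyAlg_map_const.
Qed.

Lemma degen0_tvar n (x : P n) : @degen n 0 (tvar x) = tvar (tvar x).
Proof. exact: (@pa_eval_var R (P n) (P n.+2)). Qed.

Lemma tower_ext n (E : comPzRingType) (g h : {rmorphism P n.+1 -> E}) :
  (forall a, g (alg_in (P n.+1) a) = h (alg_in (P n.+1) a)) ->
  (forall x : P n, g (tvar x) = h (tvar x)) -> g =1 h.
Proof. exact: polyalg_ext. Qed.

Lemma face_degen_id n j (x : P n.+1) : (j <= n)%N ->
  face n.+1 j (@degen n j x) = x.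
Proof.
elim: j n x => [|j IH] n x.
  move=> _; pose g : {rmorphism P n.+1 -> P n.+1} := @face R S n.+1 0 \o @degen n 0.
  apply: (@tower_ext n (P n.+1) g idfun) => [a|y].
    exact: (etrans (congr1 (@face R S n.+1 0) (@degen_const n 0 a))
      (@face_const R S n.+1 0 a)).
  exact: (etrans (congr1 (@face R S n.+1 0) (@degen0_tvar n y))
    (@face0_tvar R S n.+1 (tvar y))).
case: n x => [|n] x jn; first by exfalso.
apply: (etrans (polyAlg_map_comp _ _ _)).
by apply: polyAlg_map_id => y; exact: IH.
Qed.

Lemma faceS_degen_id n j (x : P n.+1) : (j <= n)%N ->
  face n.+1 j.+1 (@degen n j x) = x.
Proof.
elim: j n x => [|j IH] n x.
  move=> _; pose g : {rmorphism P n.+1 -> P n.+1} := @face R S n.+1 1 \o @degen n 0.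
  apply: (@tower_ext n (P n.+1) g idfun) => [a|y].
    exact: (etrans (congr1 (@face R S n.+1 1) (@degen_const n 0 a))
      (@face_const R S n.+1 1 a)).
  apply: (etrans (congr1 (@face R S n.+1 1) (@degen0_tvar n y))).
  exact: (etrans (@faceS_tvar R S n 0 (tvar y))
    (congr1 (@tvar R S n) (@face0_tvar R S n y))).
case: n x => [|n] x jn; first by exfalso.
apply: (etrans (polyAlg_map_comp _ _ _)).
by apply: polyAlg_map_id => y; exact: IH.
Qed.

Lemma face_degen_lt n i j (x : P n.+2) : (i <= j <= n)%N ->
  face n.+2 i (@degen n.+1 j.+1 x) = @degen n j (face n.+1 i x).
Proof.
elim: i n j x => [|i IH] n j x.
  move=> _.
  exact: (@counit_natural R (P n.+1) (P n.+2) (@degen n j) (@degen_const n j) x).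
case: j => [|j]; first by move=> ij; exfalso; case/andP: ij.
case: n x => [|n] x ij; first by exfalso; case/andP: ij.
apply: (etrans (polyAlg_map_comp _ _ _)).
apply: (etrans _ (esym (polyAlg_map_comp _ _ _))).
by apply: eq_polyAlg_map => y; exact: IH.
Qed.

Lemma face_degen_gt n i j (x : P n.+2) : (j <= i <= n)%N ->
  face n.+2 i.+2 (@degen n.+1 j x) = @degen n j (face n.+1 i.+1 x).
Proof.
elim: j n i x => [|j IH] n i x.
  move=> _.
  pose g : {rmorphism P n.+2 -> P n.+2} := @face R S n.+2 i.+2 \o @degen n.+1 0.
  pose h : {rmorphism P n.+2 -> P n.+2} := @degen n 0 \o @face R S n.+1 i.+1.
  apply: (@tower_ext n.+1 (P n.+2) g h) => [a|y].
    apply: (etrans (congr1 (@face R S n.+2 i.+2) (@degen_const n.+1 0 a))).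
    apply: (etrans (@face_const R S n.+2 i.+2 a)); apply: esym.
    exact: (etrans (congr1 (@degen n 0) (@face_const R S n.+1 i.+1 a))
      (@degen_const n 0 a)).
  apply: (etrans (congr1 (@face R S n.+2 i.+2) (@degen0_tvar n.+1 y))).
  apply: (etrans (@faceS_tvar R S n.+1 i.+1 (tvar y))).
  apply: (etrans (congr1 (@tvar R S n.+1) (@faceS_tvar R S n i y))); apply: esym.
  exact: (etrans (congr1 (@degen n 0) (@faceS_tvar R S n i y))
    (@degen0_tvar n (face n i y))).
case: i => [|i]; first by move=> ij; exfalso; case/andP: ij.
case: n x => [|n] x ij; first by exfalso; case/andP: ij.
apply: (etrans (polyAlg_map_comp _ _ _)).
apply: (etrans _ (esym (polyAlg_map_comp _ _ _))).
by apply: eq_polyAlg_map => y; exact: IH.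
Qed.
End Degeneracies.

Lemma sub_ACA (V : zmodType) (x y a b : V) : x - y - (a - b) = x - a - (y - b).
Proof. by rewrite !opprD !opprK addrACA. Qed.

(** * Degree zero of the base change *)

Section DegreeZero.
Context (p : nat) (R : comPzRingType) (S P1 P2 : algOver R).
Context (N : nat) (r : 'I_N -> R).
Hypothesis r_gen : forall y, exists c : 'I_N -> R, y = \sum_i c i ^+ p * r i.
Hypothesis frob_inj : forall (V : zmodType) (beta : R -> S -> V),
  balanced (frob_rel p (alg_in S)) beta ->
  forall y : 'I_N -> S, \sum_h alg_in S (r h) * y h ^+ p = 0 ->
  \sum_h beta (r h) (y h) = 0.
Context (p_prime : prime p) (charS : (p%:R : S) = 0).
Context (aug1 : {rmorphism P1 -> S}) (d0 d1 : P2 -> P1).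
Context (tv1 : S -> P1) (tv2 : P1 -> P2).
Hypothesis augC : forall a, aug1 (alg_in P1 a) = alg_in S a.
Hypothesis aug_tv : forall s, aug1 (tv1 s) = s.
Hypothesis d0_tv : forall x, d0 (tv2 x) = x.
Hypothesis d1_tv : forall x, d1 (tv2 x) = tv1 (aug1 x).

(** Modulo boundaries x (x) c depends only on [aug1 x], because [tv2 x] joins x to [tv1 (aug1 x)].
    So (a, s) |-> tv1(s) (x) a is balanced, and [frob_inj] applied to it shows that z vanishes in
    the quotient. *)
Lemma ftensor_H0 (z : {malg R[P1]}) :
  \sum_(x <- msupp z) alg_in S z@_x * aug1 x ^+ p = 0 ->
  exists w : {malg R[P2]}, ftensor_rel p (z - (push d0 w - push d1 w)).
Proof.
move=> z0.
pose U (v : {malg R[P1]}) := exists w : {malg R[P2]},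
  ftensor_rel p (v - (push d0 w - push d1 w)).
have bdB (w w' : {malg R[P2]}) : push d0 (w - w') - push d1 (w - w') =
    (push d0 w - push d1 w) - (push d0 w' - push d1 w').
  by rewrite !push_zmod_morphism !opprD !opprK addrACA.
have subF : is_subgroup (@ftensor_rel p R P1) := span_subgroup _.
have bd0 : push d0 0 - push d1 0 = 0 :> {malg R[P1]}.
  by have := bdB 0 0; rewrite !subrr.
have subU : is_subgroup U.
  split; first by exists 0; rewrite bd0 subr0; exact: (sub0 subF).
  move=> v v' [w Fw] [w' Fw']; exists (w - w').
  have -> : v - v' - (push d0 (w - w') - push d1 (w - w')) =
      (v - (push d0 w - push d1 w)) - (v' - (push d0 w' - push d1 w')).
    by rewrite bdB; exact: sub_ACA.
  exact: (subB subF).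
have relU v : ftensor_rel p v -> U v.
  by move=> Fv; exists 0; rewrite bd0 subr0.
have [V [q [qP qB qS qZ]]] := ftensor_quotient subU relU.
suff /qP : q z = 0 by [].
have q_tv c x : q << c *g x >> = q << c *g tv1 (aug1 x) >>.
  apply/eqP; rewrite -subr_eq0 -raddfB; apply/eqP/qP; exists << c *g tv2 x >>.
  by rewrite !pushU d0_tv d1_tv subrr; exact: (sub0 subF).
pose beta a s := q << a *g tv1 s >>.
have bal : balanced (frob_rel p (alg_in S)) beta.
  split=> [a a' b|a b b'|_ _ [c [-> ->]] a s]; rewrite /beta.
  - by rewrite monalgUB raddfB.
  - by rewrite -qB [RHS]q_tv rmorphB !aug_tv.
  - by rewrite -qZ [LHS]q_tv (rmorphM aug1) augC aug_tv.
have betaS a (I : Type) (t : seq I) (F : I -> S) :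
    beta a (\sum_(i <- t) F i) = \sum_(i <- t) beta a (F i).
  rewrite /beta -qS [RHS]q_tv rmorph_sum; congr (q << _ *g tv1 _ >>).
  by apply: eq_bigr => i _; rewrite aug_tv.
have [co coE] := choice_fun r_gen.
have betaE a s : beta a s = \sum_h beta (r h) (alg_in S (co a h) * s).
  rewrite {1}(coE a) /beta (raddf_sum (mkmalgU (tv1 s))) raddf_sum.
  apply: eq_bigr => h _; rewrite -/(beta _ _) -/(beta _ _).
  by apply: (balancedC bal); exists (co a h).
have -> : q z = \sum_h beta (r h)
    (\sum_(x <- msupp z) alg_in S (co z@_x h) * aug1 x).
  under eq_bigr do rewrite betaS.
  rewrite exchange_big {1}[z]monalgE raddf_sum; apply: eq_bigr => x _ /=.
  by rewrite q_tv -[LHS]/(beta _ _) betaE.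
apply: frob_inj => //; rewrite -[RHS]z0.
under eq_bigr do rewrite (frobenius_sum p_prime charS) mulr_sumr.
rewrite exchange_big; apply: eq_bigr => x _ /=.
rewrite {2}(coE z@_x) rmorph_sum mulr_suml; apply: eq_bigr => h _.
by rewrite exprMn rmorphM rmorphXn; ring.
Qed.
End DegreeZero.

(** * The theorem *)

Section StandardResolutionExact.
Context (R : comPzRingType) (S : algOver R).
Local Notation P n := (tower S n).

Local Notation bd n x := (@alt_face (fun m => P m) (fun m i => @face R S m i) n x).

Lemma tower_bd2 n (x : P n.+2) : bd n (bd n.+1 x) = 0.
Proof.
exact: (@alt_face2 (fun m => P m) (fun m i => @face R S m i)
  (fun n i j x => @face_face R S n i j x) n x).
Qed.

Lemma tower_bd_surj (y : P 0) : exists x, bd 0 x = y.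
Proof.
exists (tvar y); apply: (etrans (big_ord1 _ _)).
by rewrite expr0 mulr1z; exact: face0_tvar.
Qed.

Lemma tower_bd_exact n (x : P n.+1) : bd n x = 0 -> exists y, x = bd n.+1 y.
Proof.
exact: (@alt_face_exact (fun m => P m) (fun m i => @face R S m i)
  (fun m j => @degen R S m j) (@tvar R S)
  (fun n i j x => @face_face R S n i j x)
  (fun n i j x => @face_degen_lt R S n i j x)
  (fun n j x => @face_degen_id R S n j x)
  (fun n j x => @faceS_degen_id R S n j x)
  (fun n i j x => @face_degen_gt R S n i j x)
  (fun n x => @face0_tvar R S n x)
  (fun n i x => @faceS_tvar R S n i x) n x).
Qed.

Lemma tower_basis n : has_basis (P n.+1).
Proof. exact: polyalg_basis. Qed.

Lemma frobenius_ftensor p n (z : {malg R[P n.+1]}) :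
  frobenius_rel p z <-> ftensor_rel p z.
Proof.
split; apply: span_sub => [|v].
- exact: span_subgroup.
- by case=> [c x y|c a x]; apply: SpanG; [exact: FtensorD | exact: FtensorZ].
- exact: span_subgroup.
- by case=> [c x y|c a x]; apply: SpanG; [exact: FrobeniusD | exact: FrobeniusZ].
Qed.

Lemma tor_vanishes p n : prime p -> (p%:R : R) = 0 ->
  flat_sub (fun _ : P 0 => True) ->
  homology_vanishes (@frobenius_rel R S p) n.+1.
Proof.
move=> p_prime charR flatS z /frobenius_ftensor bz.
have [w Fw] := @ftensor_acyclic p R p_prime charR (fun m => P m)
  (fun m i => @face R S m i) (fun n i a => @face_const R S n i a)
  tower_bd2 tower_bd_surj tower_bd_exact tower_basis flatS n z bz.
by exists w; apply/frobenius_ftensor.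
Qed.
End StandardResolutionExact.

Theorem theorem5p3 (p : nat) (R S : comPzRingType) (f : {rmorphism R -> S})
    (p_prime : prime p)
    (charR : (p%:R : R) = 0) (charS : (p%:R : S) = 0)
    (noethR : noetherian_ring R) (noethS : noetherian_ring S)
    (FfinR : F_finite p R) (FfinS : F_finite p S)
    (L0 : cotangent_complex_zero (AlgOver f)) :
  relatively_perfect (AlgOver f) p.
Proof.
pose SA := AlgOver f; have [N [r r_gen]] := FfinR.
have unram := @formally_unramified R SA (L0 0%N).
have smooth := @formally_smooth R SA (L0 0%N) (L0 1%N).
have [frob_surj frob_inj] := @relative_frobenius_iso p R S f p_prime charR charS
  N r r_gen unram smooth noethS FfinS.
have frob_rels := @frobenius_relations p R S f p_prime charR charS
  N r r_gen unram smooth noethS FfinS.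
have flat0 := @relatively_perfect_flat p R S f p_prime charR charS N r r_gen
  frob_surj frob_rels noethR noethS.
have id0 : is_ideal (fun x : R => x = 0).
  split=> [|a x ->]; last exact: mulr0.
  by split=> // x y -> ->; exact: subrr.
have flatS : flat_sub (fun _ : tower SA 0 => True).
  move=> T I A u _ Au.
  have [|K [B [v [uE AB]]]] := @flat_mod_system R S f _ id0 flat0 T (enum T) I A u.
    by move=> t _; rewrite [X in ext_ideal _ _ X](Au t); exact: IdealSpan0.
  exists K, B, v; split=> // t k; apply: AB; exact: mem_enum.
have relE z : relative_frobenius p z =
    \sum_(x <- msupp z) f z@_x * @augmentation R SA 1 x ^+ p by [].
split=> [n|s|z].
- exact: tor_vanishes.
- have [y ->] := frob_surj s.
  pose phi (x : tower SA 1) (c : R) := f c * @augmentation R SA 1 x ^+ p.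
  have phiB x : zmod_morphism (phi x) by move=> a b; rewrite /phi rmorphB mulrBl.
  exists (\sum_h << r h *g @tvar R SA 0 (y h) >>).
  transitivity (lin_additive phiB (\sum_h << r h *g @tvar R SA 0 (y h) >>)).
    by [].
  rewrite raddf_sum; apply: eq_bigr => h _.
  apply: (etrans (linU phiB _ _)).
  by congr (_ * _ ^+ _); exact: (@aug_tvar0 R SA).
move=> z0; have [w Fw] := @ftensor_H0 p R SA (tower SA 1) (tower SA 2) N r r_gen
  frob_inj p_prime charS (@augmentation R SA 1) (@face R SA 1 0) (@face R SA 1 1)
  (@tvar R SA 0) (@tvar R SA 1) (@aug_const R SA 1) (@aug_tvar0 R SA)
  (@face0_tvar R SA 1) (@face1_tvar R SA) z z0.
by exists w; apply/frobenius_ftensor; rewrite boundary0E.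
Qed.
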